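(* Let $\phi$ be a divergence function with $\lim_{x\to\infty}\phi(x)/x=\infty$, let $\tau>0$, let $P$ be a probability measure on a measurable space $(\Omega,\mathcal F)$, and let $X:\Omega\to[-B,B]$ be measurable. For any $0<\epsilon\le B$ and any $\delta\in(0,1)$, we have $|\mathcal R(X)-\mathcal R_n(X)|\le\epsilon$ with probability at least $1-\delta$ if $$n\ge\frac{32768\,\Big(\sup_{\epsilon'\in[\epsilon,B]}M(\epsilon')\,\epsilon'\Big)\log\!\big(768B^2\overline L(\epsilon)^2/(\epsilon^2\tau\delta)\big)}{\epsilon^2}+\frac{64\,M(\epsilon)\log\!\big(768B^2\overline L(\epsilon)^2/(\epsilon^2\tau\delta)\big)}{\epsilon}.$$
   Context: A divergence function is a convex lower semicontinuous $\phi:\mathbb R\to[0,\infty]$ with $\phi(1)=0$ and $\phi(x)=+\infty$ for $x<0$. For a probability measure $P$ and bounded measurable $X$, $$\mathcal R(X)=\mathcal R^P(X)=\sup\Big\{\int_\Omega X\zeta\,dP:\ \zeta\ge 0 \text{ measurable},\ \int_\Omega\zeta\,dP=1,\ \int_\Omega\phi(\zeta)\,dP\le\tau\Big\}.$$ $P_n$ is the empirical distribution of $n$ i.i.d. samples from $P$, and $\mathcal R_n(X)=\mathcal R^{P_n}(X)$ (same definition with $P$ replaced by $P_n$). The growth function is $g_\phi(x)=\inf_{x'\ge x}\phi(x')/x'$ for $x\ge1$ and $g_\phi(x)=\infty$ otherwise; $g_\phi^{-1}(y)=\inf\{x: x\ge1,\ g_\phi(x)\ge y\}$ for $y>0$.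 For $\epsilon>0$ set $$L(\epsilon)=g_\phi^{-1}\Big(\frac{4B\tau}{\epsilon}\Big),\quad \underline\lambda(\epsilon)=\frac{\epsilon}{4\tau},\quad \overline L(\epsilon)=L(\epsilon)+1+\frac{2L(\epsilon)B}{\underline\lambda(\epsilon)}+\tau,\quad M(\epsilon)=(3+2L(\epsilon))B.$$ *)

(* Defs.v *)
From HB Require Import structures.
From mathcomp Require Import all_boot all_order all_algebra.
From mathcomp Require Import all_classical all_reals all_analysis.

Set Implicit Arguments.
Unset Strict Implicit.
Unset Printing Implicit Defensive.

Import Order.TTheory GRing.Theory Num.Theory.
Import numFieldNormedType.Exports.

Local Open Scope classical_set_scope.
Local Open Scope ring_scope.
Local Open Scope ereal_scope.

Section divergence.
Context {R : realType}.
Implicit Types (phi : R -> \bar R) (B tau eps : R).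

(* With the convention 0 * +oo = 0 of \bar R, the convexity inequality is trivial
   at t = 0 and t = 1, also where phi is infinite *)
Definition divergence_function phi : Prop :=
  [/\ forall x, 0 <= phi x,
      forall (x y t : R), (0 <= t <= 1)%R ->
        phi (t * x + (1 - t) * y)%R <= t%:E * phi x + (1 - t)%:E * phi y,
      lower_semicontinuous phi,
      phi 1%R = 0 &
      forall x, (x < 0)%R -> phi x = +oo].

Definition superlinear phi : Prop :=
  (fun x : R => phi x * (x^-1)%:E) x @[x --> +oo%R] --> +oo.

Definition growth_function phi (x : R) : \bar R :=
  if (1 <= x)%R
  then ereal_inf [set phi x' * (x'^-1)%:E | x' in [set x' | (x <= x')%R]]
  else +oo.

(* The infimum is taken in R: when phi is superlinear, the growth function tends
   to +oo, so that the set is nonempty (and bounded below by 1) for all y *)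
Definition growth_inv phi (y : R) : R :=
  inf [set x : R | (1 <= x)%R /\ y%:E <= growth_function phi x].

Local Open Scope ring_scope.

Definition Lval phi B tau eps : R := growth_inv phi (4 * B * tau / eps).

Definition lambda_low tau eps : R := eps / (4 * tau).

Definition Lbar phi B tau eps : R :=
  Lval phi B tau eps + 1 + 2 * Lval phi B tau eps * B / lambda_low tau eps + tau.

Definition Mval phi B tau eps : R := (3 + 2 * Lval phi B tau eps) * B.

Definition log_term phi B tau eps delta : R :=
  ln (768 * B ^+ 2 * Lbar phi B tau eps ^+ 2 / (eps ^+ 2 * tau * delta)).

End divergence.

Section risk.
Context {R : realType} {d : measure_display} {T : measurableType d}.

Definition divergence_risk (phi : R -> \bar R) (tau : R)
    (mu : {measure set T -> \bar R}) (X : T -> R) : \bar R :=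
  ereal_sup [set \int[mu]_w (X w * zeta w)%:E | zeta in
    [set zeta : T -> R |
      [/\ measurable_fun setT zeta,
          forall w, (0 <= zeta w)%R,
          \int[mu]_w (zeta w)%:E = 1 &
          \int[mu]_w phi (zeta w) <= tau%:E]]].

Definition empirical (n : nat) (x : 'I_n -> T) (A : set T) : \bar R :=
  (n%:R^-1)%:E * \sum_(i < n) \d_(x i) A.

(* The instance below holds for all n, but this is a probability only for n > 0 *)
Section empirical_measure.
Variables (n : nat) (x : 'I_n -> T).

Let empirical0 : empirical x set0 = 0.
Proof. by rewrite /empirical big1 ?mule0// => i _; rewrite measure0. Qed.

Let empirical_ge0 A : 0 <= empirical x A.
Proof.
by apply: mule_ge0; [rewrite lee_fin invr_ge0|apply: sume_ge0].
Qed.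

Let empirical_semi_sigma_additive : semi_sigma_additive (empirical x).
Proof.
move=> F mF tF mUF; rewrite /empirical.
rewrite [X in X @ \oo --> _](_ : _ = (fun k => (n%:R^-1)%:E *
    \sum_(0 <= j < k) \sum_(i < n) \d_(x i) (F j))); last first.
  apply/funext => k; rewrite ge0_sume_distrr// => j _.
  exact: sume_ge0.
apply: cvgeZl => //.
rewrite [X in _ --> X](_ : _ =
    lim ((fun k => \sum_(0 <= j < k) \sum_(i < n) \d_(x i) (F j)) @ \oo)).
  by apply: is_cvg_ereal_nneg_natsum => k _; exact: sume_ge0.
rewrite nneseries_sum//; apply: eq_bigr => /= i _.
exact: measure_semi_bigcup.
Qed.

HB.instance Definition _ := isMeasure.Build _ _ _ (empirical x)
  empirical0 empirical_ge0 empirical_semi_sigma_additive.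

End empirical_measure.
End risk.

Section sampling.
Context {R : realType} {d dS : measure_display}
  {T : measurableType d} {S : measurableType dS}.

Definition mutually_independent (Q : probability S R) (n : nat)
    (Y : 'I_n -> S -> T) : Prop :=
  forall (J : {set 'I_n}) (A : 'I_n -> set T),
    (forall i, i \in J -> measurable (A i)) ->
    Q (\bigcap_(i in [set` J]) (Y i @^-1` A i)) = \prod_(i in J) Q (Y i @^-1` A i).

(* The samples live on an arbitrary probability space (S, Q) *)
Definition iid_samples (P : probability T R) (Q : probability S R) (n : nat)
    (Y : 'I_n -> S -> T) : Prop :=
  [/\ forall i, measurable_fun setT (Y i),
      forall i (A : set T), measurable A -> Q (Y i @^-1` A) = P A &
      mutually_independent Q Y].

End sampling.

(* Main.v *)
Require Import Defs.
From mathcomp Require Import all_boot all_order all_algebra.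
From mathcomp Require Import ring lra.
From mathcomp Require Import all_classical all_reals all_analysis.
From mathcomp Require Import measurable_realfun.
Import Order.TTheory GRing.Theory Num.Theory.
Import numFieldNormedType.Exports.
Set Implicit Arguments.
Unset Strict Implicit.
Unset Printing Implicit Defensive.
Local Open Scope classical_set_scope.
Local Open Scope ring_scope.

(* Shift [X] to take values in [0, 2B]. Cutting a feasible density [zeta] off at
   [L(eps)] costs at most [eps / 2] in the objective, under [P] as under [P_n],
   because [phi(z) >= (4 B tau / eps) z] beyond [L(eps)].

   For the truncated problem under [P], maximise [(v - rho) (tau - c)] over the
   achievable pairs (objective [v], divergence [c]), with [rho] slightly below the
   optimal value. The tangent at the maximiser yields multipliers [lam], [nu] whose
   dual value exceeds the optimum by at most [eps / 3], together with a nearly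
   optimal density [zeta] whose divergence stays below [tau] by about
   [eps / (6 lam)]. Let [f] be the conjugate function of these multipliers.
   Upper bound: the empirical mean of [f(X)] bounds the empirical risk by weak duality.
   Lower bound: [zeta] remains feasible for [P_n], up to normalisation, as soon as the
   empirical mean of [lam phi(zeta)] deviates by less than [eps / 6].
   So only finitely many fixed functions must concentrate, and no uniform
   convergence over the multipliers is needed. All of them are controlled by [zeta],
   and the pointwise bound [4 B^2 z^2 <= 2 S z + S phi(z) / tau] for [z <= L(eps)],
   where [S = sup M(eps') eps'], bounds their second moments by [4 S], which is
   what Bernstein's inequality requires. *)

(** * Convex sets in the plane *)

Definition convex_rel {R : realType} (K : R -> R -> Prop) : Prop :=
  forall x1 y1 x2 y2 t, 0 <= t <= 1 -> K x1 y1 -> K x2 y2 ->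
    K (t * x1 + (1 - t) * x2) (t * y1 + (1 - t) * y2).

(** Take for [nu] the supremum of the slopes from [(t0, r)] to the points of [K] beyond [t0]. A
    segment from a point before [t0] to one beyond it crosses abscissa [t0] at height at most [r],
    so no slope on the right exceeds one on the left. *)
Lemma supporting_slope (R : realType) (K : R -> R -> Prop) (r t0 C : R) :
  convex_rel K -> 0 <= C ->
  (forall y t, K y t -> y <= r + C * Num.max (t - t0) 0) ->
  exists2 nu, 0 <= nu <= C & forall y t, K y t -> y <= r + nu * (t - t0).
Proof.
move=> cK C0 KC.
pose A := [set x | x = 0 \/ exists y t, [/\ K y t, t0 < t & x = (y - r) / (t - t0)]].
have A0 : A 0 by left.
have AC : ubound A C.
  move=> x [->//|[y [t [Kyt tt ->]]]].
  have := KC _ _ Kyt; rewrite max_l; last lra.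
  by move=> ?; rewrite ler_pdivrMr; lra.
have hA : has_sup A by split; [exists 0|exists C].
exists (sup A).
  by rewrite (ub_le_sup hA.2 A0) ge_sup//; exists 0.
move=> y t Kyt; have [tt|tt|tt] := ltgtP t0 t.
- have : (y - r) / (t - t0) <= sup A.
    by apply: ub_le_sup; [exists C|right; exists y, t].
  by rewrite ler_pdivrMr; lra.
- suff : sup A <= (r - y) / (t0 - t) by rewrite ler_pdivlMr; lra.
  apply: ge_sup; first by exists 0.
  move=> x [->|[y' [t' [Kyt' tt' ->]]]].
    have := KC _ _ Kyt; rewrite max_r; last lra.
    by move=> ?; rewrite divr_ge0//; lra.
  rewrite ler_pdivlMr; last lra.
  rewrite mulrAC ler_pdivrMr; last lra.
  (* The weight that places the mixture of the two points at abscissa [t0]. *)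
  pose w := (t' - t0) / (t' - t).
  have w01 : 0 <= w <= 1.
    by rewrite divr_ge0 /= ?ler_pdivrMr ?mul1r; lra.
  have tw : w * (t' - t) = t' - t0 by rewrite /w mulfVK//; lra.
  have := KC _ _ (cK _ _ _ _ _ w01 Kyt Kyt').
  rewrite (_ : w * t + (1 - w) * t' - t0 = 0); last first.
    rewrite (_ : w * t + _ = t' - w * (t' - t)); last ring.
    by rewrite tw; ring.
  rewrite max_l// mulr0 addr0 => h.
  have := ler_wpM2r (_ : 0 <= t' - t) h.
  rewrite (_ : (_ + _) * _ = w * (t' - t) * (y - y') + y' * (t' - t)); last ring.
  rewrite tw => /(_ ltac:(lra)); lra.
- by have := KC _ _ Kyt; rewrite -tt subrr max_r ?mulr0.
Qed.

Lemma closure_mix (R : realType) (K : R -> R -> Prop) (p : R * R) x y s :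
  convex_rel K -> 0 < s < 1 -> K x y ->
  closure [set q | K q.1 q.2] p ->
  closure [set q | K q.1 q.2] (s * x + (1 - s) * p.1, s * y + (1 - s) * p.2).
Proof.
move=> cK s01 Kxy clp U /nbhs_ballP[e /= e0 eU].
have [q [/= Kq [q1 q2]]] := clp _ (nbhsx_ballx p e e0).
exists (s * x + (1 - s) * q.1, s * y + (1 - s) * q.2); split => /=.
  by apply: cK => //; lra.
apply: eU; split; rewrite /= /ball/=.
- rewrite (_ : _ - _ = (1 - s) * (p.1 - q.1)); last by simpl; ring.
  rewrite normrM gtr0_norm; last lra.
  have : 0 <= `|p.1 - q.1| < e by rewrite normr_ge0.
  nra.
- rewrite (_ : _ - _ = (1 - s) * (p.2 - q.2)); last by simpl; ring.
  rewrite normrM gtr0_norm; last lra.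
  have : 0 <= `|p.2 - q.2| < e by rewrite normr_ge0.
  nra.
Qed.

(** First-order optimality: [G] stands for a directional derivative and [s * H] for the second-order
    remainder divided by [s]. *)
Lemma first_order_le0 (R : realType) (G H : R) :
  (exists2 s0, 0 < s0 & forall s, 0 < s < s0 -> G <= s * H) -> G <= 0.
Proof.
move=> [s0 s0p GH]; rewrite leNgt; apply/negP => G0.
pose s := Num.min (s0 / 2) (G / (2 * (`|H| + 1))).
have H1 : 0 < 2 * (`|H| + 1) by have := normr_ge0 H; lra.
have sp : 0 < s by rewrite lt_min; apply/andP; split; [lra|rewrite divr_gt0].
have ss0 : s < s0 by rewrite gt_min; apply/orP; left; lra.
have : s <= G / (2 * (`|H| + 1)) by rewrite ge_min lexx orbT.
rewrite ler_pdivlMr// => sG.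
have := GH s; rewrite sp ss0 => /(_ isT).
have := ler_norm H; nra.
Qed.

(* The point maximising the area [(x - rho) * (tau - y)] of the rectangle with
   corner [(rho, tau)], where [rho = r - 2 a], lies neither too far from [r] nor
   too close to [tau], and the tangent of the hyperbola through it supports [K]. *)
Lemma supporting_hyperbola (R : realType) (K : R -> R -> Prop) (r tau a V x0 : R) :
  convex_rel K -> 0 < tau -> 0 < a ->
  (forall x y, K x y -> x <= V /\ 0 <= y) ->
  K x0 0 ->
  (forall x y, K x y -> y <= tau -> x <= r) ->
  (forall e, 0 < e -> exists x y, [/\ K x y, y <= tau & r - e < x]) ->
  exists lam D : R, [/\ 0 < lam, D <= r + 2 * a,
    forall x y, K x y -> x + lam * (tau - y) <= D &
    forall eta, 0 < eta -> exists x y, [/\ K x y, r - a - eta <= x,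
      D - eta <= x + lam * (tau - y) & a - eta <= lam * (tau - y)]].
Proof.
move=> cK tau0 a0 Kb K0 Kr Kapp.
pose rho := r - 2 * a.
pose hK := closure [set q : R * R | K q.1 q.2].
(* [K] need not be closed, so the area is maximised over a compact part of its closure. *)
pose A : set (R * R) := (`[rho, V] `*` `[0, tau]) `&` hK.
have sK x y : K x y -> hK (x, y) by move=> ?; apply: subset_closure.
have cA : compact A.
  apply: compact_closedI; last exact: closed_closure.
  by apply: compact_setX; exact: segment_compact.
have [x1 [y1 [K1 y1t x1r]]] := Kapp _ a0.
have [x0r] : x0 <= r /\ x1 <= r by split; apply: Kr; eauto; exact: ltW.
move=> x1r'.
have y10 : 0 <= y1 by have [] := Kb _ _ K1.
(* Mixing a little of the strictly feasible [(x0, 0)] into a nearly optimal point yields positive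
   area: the second coordinate drops below [tau], and the first loses at most [a / 2]. *)
pose s1 := Num.min (1 / 2) (a / (2 * (r - x0 + 1))).
have s1p : 0 < s1 by rewrite lt_min; apply/andP; split; [lra|rewrite divr_gt0//; lra].
have s1h : s1 <= 1 / 2 by rewrite ge_min lexx.
have s1a : s1 * (2 * (r - x0 + 1)) <= a.
  by rewrite -ler_pdivlMr; [rewrite ge_min lexx orbT|lra].
pose x2 := s1 * x0 + (1 - s1) * x1.
pose y2 := s1 * 0 + (1 - s1) * y1.
have K2 : K x2 y2 by apply: cK => //; lra.
have x2r : rho < x2 by rewrite /x2 /rho; nra.
have y2t : y2 < tau by rewrite /y2 mulr0 add0r; nra.
have y20 : 0 <= y2 by have [] := Kb _ _ K2.
have Ain x y : hK (x, y) -> rho <= x -> x <= V -> 0 <= y -> y <= tau -> A (x, y).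
  by move=> *; split => //; split; rewrite /= in_itv /=; apply/andP.
have A2 : A (x2, y2).
  apply: Ain => //; [exact: sK|exact: ltW|by have [] := Kb _ _ K2|exact: ltW].
pose F (p : R * R) := (p.1 - rho) * (tau - p.2).
have cF : continuous F.
  move=> p; apply: cvgM; apply: cvgB; (try exact: cvg_cst); [exact: cvg_fst|exact: cvg_snd].
have [p Ap pmax] := compact_EVT_max (ex_intro _ _ A2) cA (continuous_subspaceT cF).
move: Ap; rewrite inE => -[[/=]]; rewrite !in_itv /= => /andP[p1r p1V] /andP[p20 p2t] hp.
have Fp : 0 < F p.
  have := pmax (x2, y2); rewrite inE => /(_ A2); apply: lt_le_trans.
  by rewrite /F/= mulr_gt0//; lra.
pose al := p.1 - rho; pose be := tau - p.2.
have al0 : 0 < al.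
  have : 0 <= al by rewrite /al; lra.
  rewrite le_eqVlt => /orP[/eqP e|//]; move: Fp.
  by rewrite /F -/al -e mul0r ltxx.
have be0 : 0 < be.
  have : 0 <= be by rewrite /be; lra.
  rewrite le_eqVlt => /orP[/eqP e|//]; move: Fp.
  by rewrite /F -/be -e mulr0 ltxx.
have hKb x y : hK (x, y) -> x <= V /\ 0 <= y.
  move=> hxy; split; apply/ler_addgt0Pr => e e0;
   have [q [/= Kq [q1 q2]]] := hxy _ (nbhsx_ballx (x, y) e e0);
   have [qV q0] := Kb _ _ Kq; move: q1 q2; rewrite /ball/= !ltr_norml; lra.
(* Moving from [p] a fraction [s] towards [(x, y)] changes the area by [s] times this expression, up
   to a term of order [s ^+ 2]. The bound [s0] keeps the moved point inside the rectangle. *)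
have opt x y : K x y -> be * (x - p.1) - al * (y - p.2) <= 0.
  move=> Kxy; apply: (first_order_le0 (H := (x - p.1) * (y - p.2))).
  pose s0 := Num.min 1 (Num.min (al / (`|x - p.1| + 1)) (be / (`|y - p.2| + 1))).
  have n1 := normr_ge0 (x - p.1); have n2 := normr_ge0 (y - p.2).
  exists s0.
    by rewrite !lt_min ltr01 /= !divr_gt0//; lra.
  move=> s /andP[sp]; rewrite !lt_min => /and3P[s1' ].
  rewrite !ltr_pdivlMr; [|lra|lra] => sal sbe.
  have hs : hK (s * x + (1 - s) * p.1, s * y + (1 - s) * p.2).
    by apply: closure_mix => //; rewrite sp.
  have [hV h0] := hKb _ _ hs.
  have e1 : s * x + (1 - s) * p.1 - rho = al + s * (x - p.1) by rewrite /al; ring.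
  have e2 : tau - (s * y + (1 - s) * p.2) = be - s * (y - p.2) by rewrite /be; ring.
  have g1 : 0 <= al + s * (x - p.1).
    have := ler_norm (- (x - p.1)); rewrite normrN; nra.
  have g2 : 0 <= be - s * (y - p.2) by have := ler_norm (y - p.2); nra.
  have : A (s * x + (1 - s) * p.1, s * y + (1 - s) * p.2) by apply: Ain => //; lra.
  rewrite -inE => /pmax; rewrite /F /= e1 e2 -/al -/be => h.
  have : 0 <= s * (s * ((x - p.1) * (y - p.2)) - (be * (x - p.1) - al * (y - p.2))).
    by lra.
  by rewrite pmulr_rge0// subr_ge0.
pose lam := al / be.
have lam0 : 0 < lam by rewrite divr_gt0.
have lb : lam * be = al by rewrite /lam mulfVK// gt_eqF.
have tan x y : K x y -> x + lam * (tau - y) <= p.1 + al.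
  move=> /opt; rewrite -(pmulr_rle0 _ (_ : 0 < be^-1)) ?invr_gt0//.
  rewrite mulrBr mulKf ?gt_eqF// mulrA (mulrC be^-1) -/lam -lb.
  rewrite /be; lra.
have p1r' : p.1 <= r.
  apply/ler_addgt0Pr => e e0.
  pose e' := Num.min e be.
  have e'0 : 0 < e' by rewrite lt_min e0.
  have [q [/= Kq [q1 q2]]] := hp _ (nbhsx_ballx p e' e'0).
  move: q1 q2; rewrite /ball/= !lt_min => /andP[q1 _] /andP[_ q2].
  have : q.1 <= r.
    apply: (Kr _ _ Kq); move: q2; rewrite ltr_norml /be; lra.
  by move: q1; rewrite ltr_norml; lra.
(* As [al = p.1 - rho], this gives [p.1 >= r - a] and [al >= a], while [p.1 <= r] bounds [p.1 + al]
   by [r + 2 * a]. *)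
have rp : r <= p.1 + al.
  apply/ler_addgt0Pr => e e0; have [x [y [Kxy yt xr]]] := Kapp _ e0.
  have := tan _ _ Kxy; have : 0 <= lam * (tau - y) by rewrite mulr_ge0//; lra.
  lra.
exists lam, (p.1 + al); split => //; first by rewrite /al /rho; lra.
move=> eta eta0.
pose e := eta / (1 + lam).
have e0 : 0 < e by rewrite divr_gt0//; lra.
have eE : e * (1 + lam) = eta by rewrite /e mulfVK//; lra.
have le0 : 0 < lam * e by rewrite mulr_gt0.
have [q [/= Kq [q1 q2]]] := hp _ (nbhsx_ballx p e e0).
move: q1 q2; rewrite /ball/= !ltr_norml => /andP[q1a q1b] /andP[q2a q2b].
have lq : lam * (tau - q.2) >= al - lam * e.
  rewrite -lb -mulrBr ler_pM2l// /be; lra.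
exists q.1, q.2; split => //; move: rp; rewrite /al /rho; move: lq; rewrite /al /rho; lra.
Qed.

(** * Real-valued expectations *)

Section real_expectation.
Context {d : measure_display} {T : measurableType d} {R : realType}.
Variable mu : {measure set T -> \bar R}.
Hypothesis mu1 : mu setT = 1%E.
Implicit Types (f g : T -> R).

(** Only total mass 1 is assumed of [mu], so that these facts apply both to [P] and to
    [empirical x]. *)
Definition intg f := mu.-integrable setT (EFin \o f).

Lemma intg_bounded f M :
  measurable_fun setT f -> (forall w, `|f w| <= M) -> intg f.
Proof.
move=> mf fM; apply: measurable_bounded_integrable => //.
  by rewrite mu1 ltry.
exists M; split; first exact: num_real.
by move=> N MN w _; apply: le_trans (ltW MN).
Qed.

Lemma intgD f g : intg f -> intg g -> intg (fun w => f w + g w).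
Proof. by move=> hf hg; exact: (integrableD measurableT hf hg). Qed.

Lemma intgB f g : intg f -> intg g -> intg (fun w => f w - g w).
Proof. by move=> hf hg; exact: (integrableB measurableT hf hg). Qed.

Lemma intgZ k f : intg f -> intg (fun w => k * f w).
Proof. by move=> hf; exact: (integrableZl measurableT k hf). Qed.

Lemma intg_cst k : intg (fun=> k).
Proof. by apply: (@intg_bounded _ `|k|). Qed.

Lemma meanD f g : intg f -> intg g ->
  \int[mu]_w (f w + g w) = \int[mu]_w f w + \int[mu]_w g w.
Proof. exact: RintegralD. Qed.

Lemma meanB f g : intg f -> intg g ->
  \int[mu]_w (f w - g w) = \int[mu]_w f w - \int[mu]_w g w.
Proof. exact: RintegralB. Qed.

Lemma meanZ k f : intg f -> \int[mu]_w (k * f w) = k * \int[mu]_w f w.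
Proof. exact: RintegralZl. Qed.

Lemma mean_cst k : \int[mu]_w k = k.
Proof. by rewrite Rintegral_cst// mu1 mulr1. Qed.

Lemma le_mean f g : intg f -> intg g -> (forall w, f w <= g w) ->
  \int[mu]_w f w <= \int[mu]_w g w.
Proof. by move=> hf hg fg; exact: le_Rintegral. Qed.

Lemma intg_measurable f : intg f -> measurable_fun setT f.
Proof. by move=> /measurable_int/measurable_EFinP. Qed.

Lemma intg_le f g : measurable_fun setT f -> intg g ->
  (forall w, `|f w| <= g w) -> intg f.
Proof.
move=> mf hg fg; apply: (le_integrable measurableT _ _ hg).
  exact/measurable_EFinP.
by move=> w _ /=; rewrite lee_fin (le_trans (fg w))// ler_norm.
Qed.

Lemma mean_EFin f : intg f -> (\int[mu]_w f w)%R%:E = (\int[mu]_w (f w)%:E)%E.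
Proof. by move=> hf; rewrite fineK//; exact: integrable_fin_num. Qed.

End real_expectation.

(** * Divergence and growth functions *)

Section divergence_facts.
Context {R : realType}.
Variable phi : R -> \bar R.
Hypothesis dphi : divergence_function phi.
Implicit Types (z c L y : R).

(** The epigraph with real heights, which keeps the value [+oo] of [phi] out of the computations. *)
Definition epi z c : Prop := (phi z <= c%:E)%E.

Lemma epi_ge0 z c : epi z c -> 0 <= z /\ 0 <= c.
Proof.
move: dphi => [p0 _ _ _ pneg] h; split.
  rewrite leNgt; apply/negP => /pneg e; move: h.
  by rewrite /epi e leye_eq.
by rewrite -lee_fin (le_trans _ h).
Qed.

Lemma epi_convex : convex_rel epi.
Proof.
move: dphi => [p0 cvx _ _ _] x1 y1 x2 y2 t t01 h1 h2; rewrite /epi.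
apply: le_trans (cvx _ _ _ t01) _; rewrite (EFinD (t * y1)) !EFinM.
move/andP: t01 => [t0 t1].
by apply: leeD; apply: lee_wpmul2l => //; rewrite lee_fin; lra.
Qed.

Lemma epi1 c : 0 <= c -> epi 1 c.
Proof. by move: dphi => [_ _ _ p1 _] c0; rewrite /epi p1 lee_fin. Qed.

(** Convexity and [phi 1 = 0] make [phi] nondecreasing beyond 1: if [L < z], then [L] is a mixture
    of [z] and 1. *)
Lemma epi_minr z c L : 1 <= L -> epi z c -> epi (Num.min z L) c.
Proof.
move=> L1 h; case: (leP z L) => // Lz.
have [_ c0] := epi_ge0 h.
pose t := (L - 1) / (z - 1).
have t01 : 0 <= t <= 1.
  by rewrite divr_ge0 /= ?ler_pdivrMr; lra.
have tE : t * (z - 1) = L - 1 by rewrite /t mulfVK//; lra.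
have := epi_convex t01 h (epi1 (lexx 0)).
rewrite (_ : _ + _ = 1 + t * (z - 1)); last ring.
rewrite tE mulr0 addr0 (_ : 1 + _ = L); last ring.
rewrite /epi => /le_trans; apply; rewrite lee_fin; nra.
Qed.

Lemma measurable_phi : measurable_fun setT phi.
Proof. by move: dphi => [_ _ lsc _ _]; exact: lower_semicontinuous_measurable. Qed.

Hypothesis sphi : superlinear phi.

Definition growth_level y := [set x : R | (1 <= x)%R /\ (y%:E <= growth_function phi x)%E].

Lemma growth_level_nonempty y : growth_level y !=set0.
Proof.
have /cvgeyPge/(_ y) := sphi; move=> [M [_ MP]].
exists (Num.max 1 (M + 1)); split; first by rewrite le_max lexx.
rewrite /growth_function le_max lexx /=.
apply: le_ereal_inf_tmp => _ [x' /= xx' <-]; apply: MP.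
by apply: lt_le_trans xx'; rewrite lt_max; apply/orP; right; lra.
Qed.

Lemma growth_inv_ge1 y : 1 <= growth_inv phi y.
Proof.
by apply: lb_le_inf; [exact: growth_level_nonempty|move=> x []].
Qed.

Lemma growth_inv_le y1 y2 : y1 <= y2 -> growth_inv phi y1 <= growth_inv phi y2.
Proof.
move=> y12; apply: lb_le_inf; first exact: growth_level_nonempty.
move=> x [x1 xy]; apply: ge_inf; first by exists 1 => ? [].
by split=> //; apply: le_trans xy; rewrite lee_fin.
Qed.

(** Some [x] of the level set lies below [z], and the infimum defining the growth function at [x]
    ranges over [phi z / z] too. *)
Lemma epi_growth_inv z c y : growth_inv phi y < z -> epi z c -> y * z <= c.
Proof.
move=> yz zc.
have [x [x1 xy] xz] := inf_lt (growth_level_nonempty y) yz.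
have z0 : 0 < z by lra.
have : (y%:E <= phi z * (z^-1)%:E)%E.
  apply: (le_trans xy); rewrite /growth_function x1.
  by apply: ereal_inf_lbound; exists z => //=; exact: ltW.
move=> h; rewrite -ler_pdivlMr// -lee_fin EFinM.
by apply: (le_trans h); apply: lee_wpmul2r => //; rewrite lee_fin invr_ge0 ltW.
Qed.

Lemma le_growth_inv z c y : 1 <= z -> epi z c -> c < y * z -> z <= growth_inv phi y.
Proof.
move=> z1 zc cy; rewrite leNgt; apply/negP => /epi_growth_inv/(_ zc); lra.
Qed.

End divergence_facts.

(** * Truncated densities and the saddle point *)

Section plays.
Context {d : measure_display} {T : measurableType d} {R : realType}.
Variables (phi : R -> \bar R) (L : R) (mu : {measure set T -> \bar R}).
Hypothesis dphi : divergence_function phi.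
Hypothesis L1 : 1 <= L.
Hypothesis mu1 : mu setT = 1%E.
Implicit Types (zeta psi : T -> R).

(* Requiring a real-valued [psi] above [phi \o zeta] keeps all expectations real. *)
Definition play zeta psi : Prop :=
  [/\ measurable_fun setT zeta, intg mu psi, forall w, zeta w <= L &
      forall w, epi phi (zeta w) (psi w)].

Lemma play_bounds zeta psi w : play zeta psi ->
  [/\ 0 <= zeta w, zeta w <= L & 0 <= psi w].
Proof. by move=> [_ _ zL /(_ w)/(epi_ge0 dphi)[]]. Qed.

Lemma play_intg zeta psi : play zeta psi -> intg mu zeta.
Proof.
move=> pl; have [mz _ _ _] := pl; apply: (intg_bounded mu1 (M := L)) => // w.
by have [z0 zL _] := play_bounds w pl; rewrite ger0_norm.
Qed.

Lemma play_convex zeta1 psi1 zeta2 psi2 t : 0 <= t <= 1 ->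
  play zeta1 psi1 -> play zeta2 psi2 ->
  play (fun w => t * zeta1 w + (1 - t) * zeta2 w)
       (fun w => t * psi1 w + (1 - t) * psi2 w).
Proof.
move=> t01 [m1 i1 L1' e1] [m2 i2 L2 e2]; split.
- by apply: measurable_funD; apply: measurable_funM.
- by apply: intgD; apply: intgZ.
- by move=> w; have := L1' w; have := L2 w; nra.
- by move=> w; apply: epi_convex.
Qed.

Lemma play_cst z c : z <= L -> epi phi z c -> play (fun=> z) (fun=> c).
Proof. by move=> zL e; split => //; exact: intg_cst. Qed.

Lemma play_if (A : T -> bool) zeta1 psi1 zeta2 psi2 : measurable_fun setT A ->
  play zeta1 psi1 -> play zeta2 psi2 ->
  play (fun w => if A w then zeta1 w else zeta2 w)
       (fun w => if A w then psi1 w else psi2 w).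
Proof.
move=> mA p1 p2; have [m1 i1 L1' e1] := p1; have [m2 i2 L2 e2] := p2; split.
- exact: measurable_fun_ifT.
- apply: (intg_le _ (intgD i1 i2)).
    by apply: measurable_fun_ifT => //; [exact: (intg_measurable i1)|exact: (intg_measurable i2)].
  move=> w; have [_ _ a1] := play_bounds w p1; have [_ _ a2] := play_bounds w p2.
  by case: ifP => _; rewrite ger0_norm//; lra.
- by move=> w; case: ifP.
- by move=> w; case: ifP.
Qed.

Variables (X : T -> R) (b : R).
Hypothesis mX : measurable_fun setT X.
Hypothesis Xb : forall w, 0 <= X w <= b.

Lemma intg_mulX (f : T -> R) (M : R) : measurable_fun setT f -> (forall w, `|f w| <= M) ->
  intg mu (fun w => X w * f w).
Proof.
move=> mf fM; apply: (intg_bounded mu1 (M := b * M)); first exact: measurable_funM.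
move=> w; rewrite normrM; have /andP[x0 xb] := Xb w; rewrite (ger0_norm x0).
by apply: ler_pM.
Qed.

Lemma play_intgX zeta psi : play zeta psi -> intg mu (fun w => X w * zeta w).
Proof.
move=> pl; have [mz _ _ _] := pl; apply: (intg_mulX (M := L)) => // w.
by have [z0 zL _] := play_bounds w pl; rewrite ger0_norm.
Qed.

Lemma play_min1 zeta psi : play zeta psi -> play (fun w => Num.min (zeta w) 1) psi.
Proof.
move=> [mz ip zL e]; split => //.
- exact: measurable_minr.
- by move=> w; rewrite ge_min zL.
- by move=> w; exact: epi_minr.
Qed.

Lemma play_max1 zeta psi : play zeta psi -> play (fun w => Num.max (zeta w) 1) psi.
Proof.
move=> pl; have [mz ip zL e] := pl; split => //.
- exact: measurable_maxr.
- by move=> w; rewrite ge_max zL.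
- move=> w; case: (leP (zeta w) 1) => // _; apply: epi1 => //.
  by have [] := play_bounds w pl.
Qed.

(* Moving [zeta] towards [min zeta 1] or [max zeta 1] decreases the divergence. *)
Lemma normalized_play zeta psi : play zeta psi ->
  exists2 zeta', play zeta' psi &
    \int[mu]_w zeta' w = 1 /\
    \int[mu]_w (X w * zeta w) - b * Num.max (\int[mu]_w zeta w - 1) 0
      <= \int[mu]_w (X w * zeta' w).
Proof.
move=> pl; set m := \int[mu]_w zeta w.
have key zeta0 s : play zeta0 psi -> 0 <= s <= 1 ->
    play (fun w => s * zeta0 w + (1 - s) * zeta w) psi.
  move=> p0 s01; have := play_convex s01 p0 pl.
  by congr (play _ _); apply/funext => w; ring.
have iz := play_intg pl.
have [m1|m1] := lerP 1 m.
- have pm := play_min1 pl; have im := play_intg pm.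
  pose q := \int[mu]_w Num.min (zeta w) 1.
  have q1 : q <= 1.
    rewrite -[leRHS](mean_cst mu1); apply: le_mean => //; first exact: intg_cst.
    by move=> w; rewrite ge_min lexx orbT.
  (* This weight gives the mixture mean 1. If [m = q], both equal 1 and division by zero returns the
     correct weight 0. *)
  pose s := (m - 1) / (m - q).
  have s01 : 0 <= s <= 1.
    have [e|mq] := eqVneq (m - q) 0; first by rewrite /s e invr0 mulr0 lexx ler01.
    have : 0 < m - q by rewrite lt_neqAle eq_sym mq; lra.
    by move=> ?; rewrite divr_ge0 /= ?ler_pdivrMr; lra.
  have sE : s * (m - q) = m - 1.
    have [e|mq] := eqVneq (m - q) 0; last by rewrite /s mulfVK.
    by rewrite e mulr0; lra.
  exists (fun w => s * Num.min (zeta w) 1 + (1 - s) * zeta w); first exact: key.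
  split.
    rewrite meanD; [|exact: intgZ..]; rewrite !meanZ// -/m -/q; lra.
  rewrite max_l; last lra.
  (* [b] times the mass taken away, which bounds the loss in the objective because [X <= b]. *)
  have e1 : b * (m - 1) = b * (s * \int[mu]_w (zeta w - Num.min (zeta w) 1)).
    by rewrite meanB// -/m -/q sE.
  have id : intg mu (fun w => zeta w - Num.min (zeta w) 1) by exact: intgB.
  rewrite e1 -meanZ// -meanZ; last exact: intgZ.
  rewrite -meanB; [|exact: play_intgX pl|do 2 apply: intgZ; exact: id].
  apply: le_mean => //.
  + by apply: intgB; [exact: play_intgX pl|do 2 apply: intgZ; exact: id].
  + exact: play_intgX (key _ _ pm s01).
  + move=> w /=; have : 0 <= zeta w - Num.min (zeta w) 1 by rewrite subr_ge0 ge_min lexx.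
    have /andP[x0 xb] := Xb w; set z1 := Num.min _ _ => zz.
    have : 0 <= (b - X w) * (s * (zeta w - z1)).
      by rewrite mulr_ge0 ?subr_ge0// mulr_ge0//; case/andP: s01.
    lra.
- have pm := play_max1 pl; have im := play_intg pm.
  pose q := \int[mu]_w Num.max (zeta w) 1.
  have q1 : 1 <= q.
    rewrite -[leLHS](mean_cst mu1); apply: le_mean => //; first exact: intg_cst.
    by move=> w; rewrite le_max lexx orbT.
  pose s := (1 - m) / (q - m).
  have s01 : 0 <= s <= 1 by rewrite divr_ge0 /= ?ler_pdivrMr; lra.
  have sE : s * (q - m) = 1 - m by rewrite /s mulfVK//; lra.
  exists (fun w => s * Num.max (zeta w) 1 + (1 - s) * zeta w); first exact: key.
  split.
    rewrite meanD; [|exact: intgZ..]; rewrite !meanZ// -/m -/q; lra.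
  rewrite max_r; last lra.
  (* Here mass is added, which cannot lower the objective because [X] is nonnegative. *)
  rewrite mulr0 subr0; apply: le_mean => //.
  + exact: play_intgX pl.
  + exact: play_intgX (key _ _ pm s01).
  + move=> w; have : zeta w <= Num.max (zeta w) 1 by rewrite le_max lexx.
    have /andP[x0 xb] := Xb w; set z1 := Num.max _ _ => zz.
    apply: ler_wpM2l => //.
    suff : 0 <= s * (z1 - zeta w) by lra.
    by apply: mulr_ge0; [case/andP: s01|lra].
Qed.

(** The achievable pairs of objective and divergence, where the divergence may be overestimated
    through the choice of [psi]. *)
Definition play_point (v c : R) : Prop := exists zeta psi,
  [/\ play zeta psi, \int[mu]_w zeta w = 1, \int[mu]_w (X w * zeta w) = v &
      \int[mu]_w psi w = c].

Lemma play_point_convex : convex_rel play_point.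
Proof.
move=> v1 c1 v2 c2 t t01 [z1 [p1 [pl1 m1 <- <-]]] [z2 [p2 [pl2 m2 <- <-]]].
exists (fun w => t * z1 w + (1 - t) * z2 w), (fun w => t * p1 w + (1 - t) * p2 w).
have i1 := play_intg pl1; have i2 := play_intg pl2.
have [_ j1 _ _] := pl1; have [_ j2 _ _] := pl2.
have k1 := play_intgX pl1; have k2 := play_intgX pl2.
split; first exact: play_convex.
- by rewrite meanD; [|exact: intgZ..]; rewrite !meanZ// m1 m2; ring.
- rewrite -!meanZ// -meanD; [|exact: intgZ..].
  by congr (Rintegral _ _ _); apply/funext => w; ring.
- by rewrite meanD; [|exact: intgZ..]; rewrite !meanZ.
Qed.

Lemma play_point_bounds v c : play_point v c -> 0 <= v <= b /\ 0 <= c.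
Proof.
move=> [z [p [pl m1 <- <-]]]; split; last first.
  by apply: Rintegral_ge0 => w _; have [] := play_bounds w pl.
have bd w : 0 <= X w * z w <= b * z w.
  have [z0 _ _] := play_bounds w pl; have /andP[x0 xb] := Xb w.
  by rewrite mulr_ge0//= ler_wpM2r.
apply/andP; split; first by apply: Rintegral_ge0 => w _; have /andP[] := bd w.
have -> : b = \int[mu]_w (b * z w) by rewrite meanZ ?m1 ?mulr1//; exact: play_intg pl.
apply: le_mean => //; [exact: play_intgX pl|exact/intgZ/(play_intg pl)|].
by move=> w; have /andP[] := bd w.
Qed.

(** The Slater point of the divergence constraint, given by the constant density 1. *)
Lemma play_point1 : play_point (\int[mu]_w X w) 0.
Proof.
exists (fun=> 1), (fun=> 0); split; rewrite ?mean_cst//.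
  by apply: play_cst => //; exact: epi1.
by congr (Rintegral _ _ _); apply/funext => w; rewrite mulr1.
Qed.

Definition play_value (tau : R) : R :=
  sup [set v | exists2 c, c <= tau & play_point v c].

Lemma play_value_has_sup tau : 0 < tau ->
  has_sup [set v | exists2 c, c <= tau & play_point v c].
Proof.
move=> tau0; split.
  by exists (\int[mu]_w X w), 0; [exact: ltW|exact: play_point1].
by exists b => v [c _ /play_point_bounds[/andP[]]].
Qed.

(** The multipliers come one after the other. [supporting_hyperbola] yields [lam] among normalised
    densities. Then [supporting_slope], applied to the pairs of penalised objective and total mass,
    yields [nu] for the normalisation. Its slope is at most [b] because [normalized_play] removes
    excess mass at cost [b] per unit. *)
Lemma approximate_saddle_point tau a : 0 < tau -> 0 < a ->
  exists lam nu D : R, [/\ 0 < lam, 0 <= nu <= b, D <= play_value tau + 2 * a,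
    forall zeta psi, play zeta psi ->
      \int[mu]_w ((X w - nu) * zeta w - lam * psi w) <= D - nu - lam * tau &
    forall eta, 0 < eta -> exists zeta psi, [/\ play zeta psi,
      \int[mu]_w zeta w = 1,
      play_value tau - a - eta <= \int[mu]_w (X w * zeta w),
      D - nu - lam * tau - eta <= \int[mu]_w ((X w - nu) * zeta w - lam * psi w) &
      a - eta <= lam * (tau - \int[mu]_w psi w)]].
Proof.
move=> tau0 a0; have hs := play_value_has_sup tau0.
have meanE zeta psi nu lam : play zeta psi ->
    \int[mu]_w ((X w - nu) * zeta w - lam * psi w) =
    \int[mu]_w (X w * zeta w) - lam * \int[mu]_w psi w - nu * \int[mu]_w zeta w.
  move=> pl; have i1 := play_intg pl; have i2 := play_intgX pl.
  have [_ i3 _ _] := pl.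
  rewrite -!meanZ// -!meanB//; try by [exact: intgZ|apply: intgB => //; exact: intgZ].
  by congr (Rintegral _ _ _); apply/funext => w; ring.
have [lam [D [lam0 Dr DK near]]] : exists lam D : R, [/\ 0 < lam,
    D <= play_value tau + 2 * a,
    forall v c, play_point v c -> v + lam * (tau - c) <= D &
    forall eta, 0 < eta -> exists v c, [/\ play_point v c, play_value tau - a - eta <= v,
      D - eta <= v + lam * (tau - c) & a - eta <= lam * (tau - c)]].
  apply: (supporting_hyperbola (V := b) play_point_convex tau0 a0 _ play_point1).
  - by move=> v c /play_point_bounds[/andP[]].
  - by move=> v c vc ct; apply: ub_le_sup; [exact: hs.2|exists c].
  - move=> e e0; have [v [c ct vc] ev] := sup_adherent e0 hs.
    by exists v, c.
pose K w m := exists zeta psi, [/\ play zeta psi, \int[mu]_w zeta w = m &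
   \int[mu]_w (X w * zeta w) - lam * \int[mu]_w psi w = w].
have cK : convex_rel K.
  move=> w1 m1 w2 m2 t t01 [z1 [p1 [pl1 <- <-]]] [z2 [p2 [pl2 <- <-]]].
  exists (fun w => t * z1 w + (1 - t) * z2 w), (fun w => t * p1 w + (1 - t) * p2 w).
  have i1 := play_intg pl1; have i2 := play_intg pl2.
  have [_ j1 _ _] := pl1; have [_ j2 _ _] := pl2.
  have k1 := play_intgX pl1; have k2 := play_intgX pl2.
  split; first exact: play_convex.
  - by rewrite meanD; [|exact: intgZ..]; rewrite !meanZ.
  - rewrite meanD; [|exact: intgZ..]; rewrite !meanZ//.
    rewrite (_ : \int[mu]_w _ = t * \int[mu]_w (X w * z1 w) +
      (1 - t) * \int[mu]_w (X w * z2 w)); first ring.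
    rewrite -!meanZ// -meanD; [|exact: intgZ..].
    by congr (Rintegral _ _ _); apply/funext => w; ring.
have b0 : 0 <= b.
  by have [/andP[v0 vb] _] := play_point_bounds play_point1; exact: le_trans vb.
have [nu nub nuK] : exists2 nu, 0 <= nu <= b &
    forall w m, K w m -> w <= (D - lam * tau) + nu * (m - 1).
  apply: supporting_slope => // w m [z [p [pl <- <-]]].
  have [z' pl' [m1 le]] := normalized_play pl.
  have : play_point (\int[mu]_w (X w * z' w)) (\int[mu]_w p w) by exists z', p.
  by move=> /DK; lra.
exists lam, nu, D; split => //.
  move=> z p pl; rewrite meanE//.
  have := nuK _ _ (ex_intro _ z (ex_intro _ p (And3 pl erefl erefl))); lra.
move=> eta eta0; have [v [c [[z [p [pl m1 <- <-]]] vr Dv al]]] := near _ eta0.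
by exists z, p; split => //; rewrite meanE// m1; lra.
Qed.

End plays.

(** * The conjugate function *)

Section conjugate.
Context {R : realType}.
Variables (phi : R -> \bar R) (L nu lam : R).
Hypothesis dphi : divergence_function phi.
Hypothesis L1 : 1 <= L.
Hypothesis lam0 : 0 <= lam.
Implicit Types (x z c : R).

(** Its supremum is the convex conjugate, taken at [x - nu], of [lam * phi] restricted to
    [z <= L]. *)
Definition tconj_set x :=
  [set v | exists z c, [/\ z <= L, epi phi z c & v = (x - nu) * z - lam * c]].

Definition tconj x : R := sup (tconj_set x).

Lemma tconj_set_has_sup x : has_sup (tconj_set x).
Proof.
split; first by exists ((x - nu) * 1 - lam * 0), 1, 0; split => //; exact: epi1.
exists (`|x - nu| * L) => _ [z [c [zL e ->]]]; have [z0 c0] := epi_ge0 dphi e.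
have h1 : (x - nu) * z <= `|x - nu| * L.
  apply: (@le_trans _ _ (`|x - nu| * z)); first by rewrite ler_wpM2r// ler_norm.
  by rewrite ler_wpM2l.
have : 0 <= lam * c by rewrite mulr_ge0.
lra.
Qed.

Lemma tconj_ge x z c : z <= L -> epi phi z c -> (x - nu) * z - lam * c <= tconj x.
Proof.
move=> zL e; apply: ub_le_sup; first exact: (tconj_set_has_sup x).2.
by exists z, c.
Qed.

Lemma tconj_le x M :
  (forall z c, 0 <= z -> z <= L -> epi phi z c -> 0 <= c -> (x - nu) * z - lam * c <= M) ->
  tconj x <= M.
Proof.
move=> h; apply: ge_sup; first exact: (tconj_set_has_sup x).1.
by move=> _ [z [c [zL e ->]]]; have [z0 c0] := epi_ge0 dphi e; exact: h.
Qed.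

(** [tconj] is a supremum of affine functions with slopes [z] in [[0, L]]. This accounts for its
    monotonicity and for the Lipschitz bound that follows. *)
Lemma tconj_nondecreasing : {homo tconj : x y / x <= y}.
Proof.
move=> x y xy; apply: tconj_le => z c z0 zL e _; have := tconj_ge y zL e; nra.
Qed.

Lemma tconj_lipschitz x y : x <= y -> tconj y <= tconj x + L * (y - x).
Proof.
move=> xy; apply: tconj_le => z c z0 zL e _; have := tconj_ge x zL e; nra.
Qed.

Lemma tconj_ge_sub x : x - nu <= tconj x.
Proof. by have := tconj_ge x L1 (epi1 dphi (lexx 0)); rewrite mulr1 mulr0 subr0. Qed.

Lemma measurable_tconj : measurable_fun setT tconj.
Proof. by apply: nondecreasing_measurable => //; exact: tconj_nondecreasing. Qed.

Context {d : measure_display} {T : measurableType d}.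
Variables (mu : {measure set T -> \bar R}) (X : T -> R) (b : R).
Hypothesis mu1 : mu setT = 1%E.
Hypothesis mX : measurable_fun setT X.
Hypothesis Xb : forall w, 0 <= X w <= b.

Lemma tconj_bounds w : tconj 0 <= tconj (X w) <= tconj 0 + L * b.
Proof.
have /andP[x0 xb] := Xb w; rewrite tconj_nondecreasing//=.
apply: (le_trans (tconj_lipschitz x0)); rewrite subr0 lerD2l ler_wpM2l//.
exact: le_trans L1.
Qed.

Lemma measurable_tconjX : measurable_fun setT (fun w => tconj (X w)).
Proof. exact: measurableT_comp measurable_tconj mX. Qed.

Lemma intg_tconj : intg mu (fun w => tconj (X w)).
Proof.
apply: (intg_bounded mu1 (M := `|tconj 0| + L * b)); first exact: measurable_tconjX.
move=> w; have /andP[c1 c2] := tconj_bounds w.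
have := ler_norm (tconj 0); have := ler_norm (- tconj 0); rewrite normrN => n1 n2.
by rewrite ler_norml; apply/andP; split; lra.
Qed.

(** A measurable selection among finitely many constants: each step switches to the next constant on
    the measurable set where it is at least as good. *)
Lemma play_max_constants (z c : nat -> R) N :
  (forall j, z j <= L /\ epi phi (z j) (c j)) ->
  exists zeta psi, play phi L mu zeta psi /\ forall w j, (j <= N)%N ->
    (X w - nu) * z j - lam * c j <= (X w - nu) * zeta w - lam * psi w.
Proof.
move=> zc; elim: N => [|N [zeta [psi [pl IH]]]].
  exists (fun=> z 0), (fun=> c 0); split.
    by apply: play_cst => //; case: (zc 0).
  by move=> w [|j].
have pl' : play phi L mu (fun=> z N.+1) (fun=> c N.+1).
  by apply: play_cst => //; case: (zc N.+1).
pose A w := (X w - nu) * zeta w - lam * psi w <= (X w - nu) * z N.+1 - lam * c N.+1.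
have [mz ip _ _] := pl; have mp := intg_measurable ip.
have mA : measurable_fun setT A.
  by apply: measurable_fun_ler; apply: measurable_funB; apply: measurable_funM => //;
    apply: measurable_funB.
exists (fun w => if A w then z N.+1 else zeta w), (fun w => if A w then c N.+1 else psi w).
split; first exact: play_if.
move=> w j; rewrite leq_eqVlt ltnS => /orP[/eqP ->|/(IH w) h].
  by case: ifPn => // /negP; rewrite /A; lra.
by case: ifPn => //; rewrite /A; exact: le_trans.
Qed.

(** Allows exchanging supremum and expectation. [X] is rounded down to a grid, and each of the
    finitely many grid points needs just one nearly optimal constant. *)
Lemma near_maximal_play (eta : R) : 0 < eta ->
  exists zeta psi, play phi L mu zeta psi /\ forall w,
    tconj (X w) - eta <= (X w - nu) * zeta w - lam * psi w.
Proof.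
(* With this mesh, the Lipschitz bound limits the cost of rounding to [eta / 2]. The other half is
   spent on the choice of the constants. *)
move=> eta0; have hL := L1; pose e := eta / (2 * L).
have e0 : 0 < e by rewrite divr_gt0//; lra.
have eL : L * e = eta / 2 by rewrite /e; field; lra.
have /choice[zc zcP] : forall j : nat, exists p : R * R,
    [/\ p.1 <= L, epi phi p.1 p.2 &
        tconj (e * j%:R) - eta / 2 <= (e * j%:R - nu) * p.1 - lam * p.2].
  move=> j; have eta2 : 0 < eta / 2 by lra.
  have [_ [z [c [zL ep ->]]] h] := sup_adherent eta2 (tconj_set_has_sup (e * j%:R)).
  by exists (z, c); split => //; exact: ltW.
have [|zeta [psi [pl plP]]] := @play_max_constants (fun j => (zc j).1)
    (fun j => (zc j).2) (Num.truncn (b / e)).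
  by move=> j; have [] := zcP j.
exists zeta, psi; split => // w.
have /andP[x0 xb] := Xb w.
pose j := Num.truncn (X w / e).
have jN : (j <= Num.truncn (b / e))%N.
  by apply: le_truncn; rewrite ler_wpM2r// invr_ge0 ltW.
have xe : 0 <= X w / e by rewrite divr_ge0// ltW.
have /andP[j1 j2] := truncn_itv xe.
rewrite -/j ler_pdivlMr// in j1; rewrite -/j ltr_pdivrMr// -natr1 in j2.
apply: le_trans (plP w j jN).
have [zL ep h] := zcP j; have [z0 _] := epi_ge0 dphi ep.
have ejx : e * j%:R <= X w by rewrite mulrC.
have := tconj_lipschitz ejx; nra.
Qed.

Lemma mean_tconj_le M :
  (forall zeta psi, play phi L mu zeta psi ->
     \int[mu]_w ((X w - nu) * zeta w - lam * psi w) <= M) ->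
  \int[mu]_w tconj (X w) <= M.
Proof.
move=> h; apply/ler_addgt0Pr => eta eta0.
have [zeta [psi [pl plP]]] := near_maximal_play eta0.
have ip : intg mu (fun w => (X w - nu) * zeta w - lam * psi w).
  have [_ ips _ _] := pl.
  have -> : (fun w => (X w - nu) * zeta w - lam * psi w) =
    (fun w => X w * zeta w - nu * zeta w - lam * psi w).
    by apply/funext => w; ring.
  apply: intgB; last exact: intgZ.
  apply: intgB; first exact: (play_intgX dphi mu1 mX Xb pl).
  exact/intgZ/(play_intg dphi mu1 pl).
have := h _ _ pl.
have : \int[mu]_w (tconj (X w) - eta) <= \int[mu]_w ((X w - nu) * zeta w - lam * psi w).
  by apply: le_mean => //; apply: intgB; [exact: intg_tconj|exact: intg_cst].
by rewrite meanB ?mean_cst//; [lra|exact: intg_tconj|exact: intg_cst].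
Qed.

(** Weak duality, by integrating Young's inequality. The sign of [nu] admits total mass below 1. *)
Lemma mean_play_le_tconj zeta psi tau : 0 <= nu -> play phi L mu zeta psi ->
  \int[mu]_w zeta w <= 1 -> \int[mu]_w psi w <= tau ->
  \int[mu]_w (X w * zeta w) <= \int[mu]_w tconj (X w) + nu + lam * tau.
Proof.
move=> nu0 pl m1 pt; have [_ ips zL ep] := pl.
have iz := play_intg dphi mu1 pl.
have : \int[mu]_w (X w * zeta w) <=
    \int[mu]_w (tconj (X w) + (nu * zeta w + lam * psi w)).
  apply: le_mean => //; first exact: (play_intgX dphi mu1 mX Xb pl).
    by apply: intgD; [exact: intg_tconj|apply: intgD; exact: intgZ].
  by move=> w; have := tconj_ge (X w) (zL w) (ep w); lra.
rewrite meanD; [|exact: intg_tconj|by apply: intgD; exact: intgZ].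
rewrite meanD; [|exact: intgZ..]; rewrite !meanZ//.
have := ler_wpM2l nu0 m1; have := ler_wpM2l lam0 pt; lra.
Qed.

End conjugate.

(** * Truncation of the risk *)

Section risk_bounds.
Context {d : measure_display} {T : measurableType d} {R : realType}.
Variables (phi : R -> \bar R) (tau y B : R) (mu : {measure set T -> \bar R}) (X : T -> R).
Hypothesis dphi : divergence_function phi.
Hypothesis sphi : superlinear phi.
Hypothesis mu1 : mu setT = 1%E.
Hypothesis tau0 : 0 < tau.
Hypothesis y0 : 0 < y.
Hypothesis B0 : 0 < B.
Hypothesis mX : measurable_fun setT X.
Hypothesis XB : forall w, - B <= X w <= B.

Local Notation L := (growth_inv phi y).
Local Notation X' := (fun w => X w + B).

Lemma shift_bounds w : 0 <= X' w <= 2 * B.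
Proof. by have := XB w; lra. Qed.

Lemma measurable_shift : measurable_fun setT X'.
Proof. exact: measurable_funD. Qed.

Lemma mean_shift zeta : intg mu zeta -> \int[mu]_w zeta w = 1 ->
  (\int[mu]_w (X w * zeta w)%:E)%E = (\int[mu]_w (X' w * zeta w) - B)%:E
  /\ intg mu (fun w => X' w * zeta w).
Proof.
move=> iz m1.
have iX : intg mu (fun w => X w * zeta w).
  apply: (intg_le (g := fun w => B * `|zeta w|)).
  - by apply: measurable_funM => //; exact: intg_measurable iz.
  - by apply: intgZ; exact: (integrable_abse iz).
  - by move=> w; rewrite normrM ler_wpM2r// ler_norml XB.
have -> : (fun w => X' w * zeta w) = (fun w => X w * zeta w + B * zeta w).
  by apply/funext => w; ring.
split; last by apply: intgD => //; exact: intgZ.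
rewrite -mean_EFin// meanD//; last exact: intgZ.
by rewrite meanZ// m1; congr EFin; ring.
Qed.

(** Beyond [L] one has [y * z <= phi z], hence pointwise [X' * zeta <= X' * zeta' + (2 * B / y) *
    phi zeta]. Integration turns the last term into [2 * B * tau / y]. *)
Lemma truncated_play (zeta : T -> R) : measurable_fun setT zeta -> (forall w, 0 <= zeta w) ->
  (\int[mu]_w (zeta w)%:E = 1)%E -> (\int[mu]_w phi (zeta w) <= tau%:E)%E ->
  exists zeta' psi, [/\ play phi L mu zeta' psi, \int[mu]_w zeta' w <= 1,
    \int[mu]_w psi w <= tau &
    (\int[mu]_w (X w * zeta w)%:E <=
      (\int[mu]_w (X' w * zeta' w) + 2 * B * tau / y - B)%:E)%E].
Proof.
move=> mz z0 m1 pt.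
have hB := B0; have hy := y0.
have [phi0 _ _ phi1 _] := dphi.
have L1 : 1 <= L by exact: growth_inv_ge1.
have mphi : measurable_fun setT (fun w => phi (zeta w)).
  exact: (measurableT_comp (measurable_phi dphi) mz).
have iz : intg mu zeta.
  apply/integrableP; split; first exact/measurable_EFinP.
  rewrite (_ : (fun w => _) = EFin \o zeta); first by rewrite m1 ltry.
  by apply/funext => w /=; rewrite ger0_norm.
pose psi w := fine (phi (zeta w)).
have psi0 w : 0 <= psi w by exact: fine_ge0.
have psiE w : ((psi w)%:E <= phi (zeta w))%E.
  rewrite /psi; have := phi0 (zeta w); case: (phi (zeta w)) => [r| |] //= _.
have mpsi : measurable_fun setT psi.
  exact: (measurableT_comp (fine_measurable measurableT) mphi).
have psi_tau : (\int[mu]_w (psi w)%:E <= tau%:E)%E.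
  apply: le_trans pt; apply: ge0_le_integral => //.
  - by move=> w _; rewrite lee_fin.
  - exact/measurable_EFinP.
have ipsi : intg mu psi.
  apply/integrableP; split; first exact/measurable_EFinP.
  rewrite (_ : (fun w => _) = EFin \o psi); first exact: le_lt_trans psi_tau (ltry _).
  by apply/funext => w /=; rewrite ger0_norm.
(* On this set [fine] returns 0, so the density is reset to 1, where [phi] vanishes. *)
pose bad w := phi (zeta w) == +oo%E.
pose zeta1 w := if bad w then 1 else zeta w.
have ez1 w : epi phi (zeta1 w) (psi w).
  rewrite /zeta1 /bad; case: ifPn => [_|]; first exact: epi1.
  rewrite /epi /psi; have := phi0 (zeta w); case: (phi (zeta w)) => [r| |] //=.
have mbad : measurable_fun setT bad.
  apply: measurable_fun_eqe => //.
have mz1 : measurable_fun setT zeta1 by exact: measurable_fun_ifT.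
pose zeta' w := Num.min (zeta1 w) L.
have pl : play phi L mu zeta' psi.
  split => //; first exact: measurable_minr.
    by move=> w; rewrite /zeta' ge_min lexx orbT.
  by move=> w; exact: epi_minr.
have zL w : 0 <= zeta' w <= L by have [? ? _] := play_bounds dphi w pl; apply/andP.
have iz' := play_intg dphi mu1 pl.
have m1' : \int[mu]_w zeta w = 1 by rewrite /Rintegral m1.
have [ipX mXE] := mean_shift iz m1'.
exists zeta', psi; split => //.
(* Resetting to 1 may add mass only where [phi zeta] is infinite, so [zeta' <= zeta + k * phi zeta]
   everywhere for each [k > 0]. Letting [k] tend to 0 replaces an argument about null sets. *)
- suff : forall k, 0 < k -> \int[mu]_w zeta' w <= 1 + k * tau.
    move=> h; apply/ler_addgt0Pr => e e0.
    by have := h (e / tau); rewrite mulfVK ?gt_eqF// => -> //; rewrite divr_gt0.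
  move=> k k0; rewrite -lee_fin mean_EFin// EFinD EFinM -m1.
  apply: (@le_trans _ _ (\int[mu]_w (zeta w)%:E + k%:E * \int[mu]_w phi (zeta w))%E);
    last by rewrite leeD2l// lee_wpmul2l// lee_fin ltW.
  rewrite -ge0_integralZl//; last by rewrite lee_fin ltW.
  rewrite -ge0_integralD//; [|by move=> w _; rewrite lee_fin|exact/measurable_EFinP|
    by move=> w _; rewrite mule_ge0// lee_fin ltW|exact: measurable_funeM].
  apply: ge0_le_integral => //.
  + by move=> w _; rewrite lee_fin; case/andP: (zL w).
  + by apply/measurable_EFinP; exact: measurable_minr.
  + by apply: emeasurable_funD; [exact/measurable_EFinP|exact: measurable_funeM].
  + move=> w _; have := phi0 (zeta w); rewrite /zeta' /zeta1 /bad.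
    case: (phi (zeta w)) => [r| |] //= r0; last by rewrite gt0_muley ?lte_fin// addey// leey.
    rewrite -EFinM -EFinD lee_fin; rewrite lee_fin in r0.
    by rewrite ge_min; apply/orP; left; rewrite lerDl mulr_ge0// ltW.
- by rewrite -lee_fin mean_EFin.
- have iX' := play_intgX dphi mu1 measurable_shift shift_bounds pl.
  rewrite ipX lee_fin lerD2r -lee_fin EFinD !mean_EFin//.
  have by0 : 0 <= 2 * B / y by rewrite divr_ge0//; lra.
  rewrite (_ : 2 * B * tau / y = 2 * B / y * tau); last by rewrite mulrAC.
  rewrite EFinM.
  apply: (@le_trans _ _ (\int[mu]_w (X' w * zeta' w)%:E +
    (2 * B / y)%:E * \int[mu]_w phi (zeta w))%E);
    last by rewrite leeD2l// lee_wpmul2l.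
  have X0 w : 0 <= X' w by case/andP: (shift_bounds w).
  have mX' := measurable_shift.
  rewrite -ge0_integralZl//.
  have p1 w : (0 <= (X' w * zeta' w)%:E)%E by rewrite lee_fin mulr_ge0//; case/andP: (zL w).
  have mz' : measurable_fun setT zeta' by exact: measurable_minr.
  rewrite -ge0_integralD//; [|by apply/measurable_EFinP; exact: measurable_funM|
    by move=> w _; rewrite mule_ge0|exact: measurable_funeM].
  apply: ge0_le_integral => //.
  + by move=> w _; rewrite lee_fin mulr_ge0.
  + by apply/measurable_EFinP; exact: measurable_funM.
  + by apply: emeasurable_funD; [apply/measurable_EFinP; exact: measurable_funM|exact: measurable_funeM].
  + move=> w _; have phz := phi0 (zeta w); have ez := ez1 w.
    move: phz ez; rewrite /zeta' /zeta1 /bad /psi.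
    case: (phi (zeta w)) => [r| |] //=; last first.
      by move=> _ _; rewrite gt0_muley ?lte_fin ?divr_gt0 ?mulr_gt0// addey// leey.
    rewrite lee_fin => r0 ez; rewrite -EFinM -EFinD lee_fin.
    case: (leP (zeta w) L) => [zwL|Lz].
      by rewrite lerDl mulr_ge0.
    have yz := epi_growth_inv sphi Lz ez.
    have /andP[x0 xb] := shift_bounds w.
    have xz : X' w * zeta w <= 2 * B * (r / y).
      apply: ler_pM => //.
      by rewrite ler_pdivlMr// mulrC.
    have : 0 <= X' w * L by rewrite mulr_ge0//; lra.
    rewrite (mulrAC (2 * B) _ r) -(mulrA (2 * B)).
    by move: xz; lra.
Qed.

Lemma risk_le M :
  (forall zeta psi, play phi L mu zeta psi -> \int[mu]_w zeta w <= 1 ->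
    \int[mu]_w psi w <= tau -> \int[mu]_w (X' w * zeta w) <= M) ->
  (divergence_risk phi tau mu X <= (M + 2 * B * tau / y - B)%:E)%E.
Proof.
move=> h; apply: ge_ereal_sup => _ [zeta [mz z0 m1 pt] <-].
have [zeta' [psi [pl m1' pt' le]]] := truncated_play mz z0 m1 pt.
by apply: (le_trans le); rewrite lee_fin; have := h _ _ pl m1' pt'; lra.
Qed.

Lemma risk_ge zeta psi : play phi L mu zeta psi -> \int[mu]_w psi w <= tau ->
  ((\int[mu]_w (X' w * zeta w) - 2 * B * Num.max (\int[mu]_w zeta w - 1) 0 - B)%:E
    <= divergence_risk phi tau mu X)%E.
Proof.
have L1 : 1 <= L by exact: growth_inv_ge1.
move=> pl pt; have [zeta' pl' [m1 le]] :=
  normalized_play dphi L1 mu1 measurable_shift shift_bounds pl.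
have iz := play_intg dphi mu1 pl'; have [mz ip _ ep] := pl'.
have [E _] := mean_shift iz m1.
apply: (@le_trans _ _ (\int[mu]_w (X w * zeta' w)%:E)%E); first by rewrite E lee_fin; lra.
apply: ereal_sup_ubound; exists zeta' => //; split => //.
- by move=> w; have [] := play_bounds dphi w pl'.
- by rewrite -mean_EFin// m1.
- have [phi0 _ _ _ _] := dphi.
  apply: (@le_trans _ _ (\int[mu]_w (psi w)%:E)%E); last by rewrite -mean_EFin// lee_fin.
  apply: ge0_le_integral => //.
  + exact: (measurableT_comp (measurable_phi dphi) mz).
  + by apply/measurable_EFinP; exact: (intg_measurable ip).
  + by move=> w _; exact: ep.
Qed.

Lemma risk_le_play_value :
  (divergence_risk phi tau mu X <=
    (play_value phi L mu X' tau + 2 * B * tau / y - B)%:E)%E.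
Proof.
have L1 : 1 <= L by exact: growth_inv_ge1.
apply: risk_le => zeta psi pl m1 pt.
have [zeta' pl' [m1' le]] := normalized_play dphi L1 mu1 measurable_shift shift_bounds pl.
have h := play_value_has_sup dphi L1 mu1 measurable_shift shift_bounds tau0.
have : \int[mu]_w (X' w * zeta' w) <= play_value phi L mu X' tau.
  apply: ub_le_sup; first exact: h.2.
  by exists (\int[mu]_w psi w) => //; exists zeta', psi.
by move: le; rewrite max_r; lra.
Qed.

Lemma play_value_le_risk :
  ((play_value phi L mu X' tau - B)%:E <= divergence_risk phi tau mu X)%E.
Proof.
have L1 : 1 <= L by exact: growth_inv_ge1.
have h := play_value_has_sup dphi L1 mu1 measurable_shift shift_bounds tau0.
apply/lee_addgt0Pr => e e0.
have [v [c ct [zeta [psi [pl m1 <- pc]]]] ev] := sup_adherent e0 h.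
rewrite -leeBlDr// -EFinB; apply: le_trans (risk_ge pl _); last by rewrite pc.
by rewrite lee_fin m1 subrr max_l// mulr0 /play_value; lra.
Qed.

End risk_bounds.

(** * Independent samples *)

Section finite_sums.
Context {d : measure_display} {T : measurableType d} {R : realType}.
Variable mu : {measure set T -> \bar R}.

Lemma intg_sum (I : Type) (r : seq I) (F : I -> T -> R) :
  (forall i, intg mu (F i)) -> intg mu (fun w => \sum_(i <- r) F i w).
Proof.
move=> iF; elim: r => [|i r IH].
  under [X in intg _ X]funext do rewrite big_nil.
  exact: integrable0.
under [X in intg _ X]funext do rewrite big_cons.
exact: intgD.
Qed.

Lemma mean_sum (I : Type) (r : seq I) (F : I -> T -> R) :
  (forall i, intg mu (F i)) ->
  \int[mu]_w (\sum_(i <- r) F i w) = \sum_(i <- r) \int[mu]_w F i w.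
Proof.
move=> iF; elim: r => [|i r IH].
  under eq_Rintegral do rewrite big_nil.
  by rewrite big_nil /Rintegral integral0.
under eq_Rintegral do rewrite big_cons.
rewrite big_cons meanD//; first by rewrite IH.
exact: intg_sum.
Qed.

Lemma mean_indic (A : set T) : measurable A -> \int[mu]_w (\1_A w : R) = fine (mu A).
Proof. by move=> mA; rewrite /Rintegral integral_indic// setIT. Qed.

End finite_sums.

Lemma measure_bigsetU_le {d : measure_display} {T : measurableType d} {R : realType}
  (mu : {measure set T -> \bar R}) (I : Type) (r : seq I) (F : I -> set T) :
  (forall i, measurable (F i)) ->
  (mu (\big[setU/set0]_(i <- r) F i) <= \sum_(i <- r) mu (F i))%E.
Proof.
move=> mF; elim: r => [|i r IH]; first by rewrite !big_nil measure0.
rewrite !big_cons; apply: le_trans (measureU2 _ (mF i) _) _.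
  exact: bigsetU_measurable.
exact: leeD2l.
Qed.

(** From [expR (- x / 2) >= 1 - x / 2] one gets [expR x <= (1 - x / 2) ^- 2], and [(1 - x / 2) ^+ 2
    * (1 + x + x ^+ 2) = 1 + x ^+ 2 * (1 - 3 * x + x ^+ 2) / 4]. *)
Lemma expR_le_quadratic (R : realType) (x : R) : x <= 1 / 3 -> expR x <= 1 + x + x ^+ 2.
Proof.
move=> x3; set u := expR (x / 2).
have -> : expR x = u ^+ 2 by rewrite expr2 -expRD -splitr.
have u0 : 0 < u by exact: expR_gt0.
have u1 : u * (1 - x / 2) <= 1.
  have := expR_ge1Dx (- (x / 2)); rewrite expRN -/u => h.
  by have := ler_wpM2l (ltW u0) h; rewrite mulfV ?gt_eqF.
have v0 : 0 < 1 - x / 2 by lra.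
have u2 : (u * (1 - x / 2)) ^+ 2 <= 1.
  by rewrite expr_le1// mulr_ge0// ltW.
have v2 : 0 < (1 - x / 2) ^+ 2 by rewrite exprn_gt0.
rewrite -(ler_pM2r v2) -exprMn; apply: le_trans u2 _.
have q : 0 <= 1 - 3 * x + x ^+ 2 by nra.
have : 0 <= x ^+ 2 * (1 - 3 * x + x ^+ 2) by rewrite mulr_ge0// sqr_ge0.
rewrite !expr2; lra.
Qed.

Section independence.
Context {R : realType} {d dS : measure_display}
  {T : measurableType d} {S : measurableType dS}.
Variables (P : probability T R) (Q : probability S R) (n : nat) (Y : 'I_n -> S -> T).
Hypothesis iidY : iid_samples P Q Y.

Let P1 : P setT = 1%E. Proof. exact: probability_setT. Qed.
Let Q1 : Q setT = 1%E. Proof. exact: probability_setT. Qed.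

Lemma measurable_sample i : measurable_fun setT (Y i).
Proof. by case: iidY. Qed.

Lemma sample_preimage i A : measurable A -> measurable (Y i @^-1` A).
Proof. by move=> mA; rewrite -[X in measurable X]setTI; exact: measurable_sample. Qed.

Lemma mean_prod_indic (A : 'I_n -> set T) : (forall i, measurable (A i)) ->
  \int[Q]_s (\prod_(i < n) (\1_(A i) (Y i s) : R)) = \prod_(i < n) fine (P (A i)).
Proof.
move=> mA; have [_ law ind] := iidY.
pose C := \bigcap_(i in [set` [set: 'I_n]%SET]) (Y i @^-1` A i).
have mC : measurable C.
  apply: fin_bigcap_measurable => //.
  by move=> i _; exact: sample_preimage.
have -> : (fun s => \prod_(i < n) (\1_(A i) (Y i s) : R)) = \1_C.
  apply/funext => s; rewrite indicE; case: (boolP (s \in C)) => sC.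
    rewrite big1// => i _; rewrite indicE mem_set//.
    by move: sC; rewrite inE => /(_ i); apply; rewrite /= inE.
  have /existsNP[i /not_implyP[_ Ai]] : ~ C s by move=> h; move/negP: sC; apply; rewrite inE.
  by rewrite (bigD1 i)//= indicE memNset// mul0r.
transitivity (fine (Q C)); first exact: mean_indic.
rewrite (ind _ A (fun i _ => mA i)).
have -> : (\prod_(i in [set: 'I_n]%SET) Q (Y i @^-1` A i) =
    \prod_(i < n) (fine (P (A i)))%:E)%E.
  rewrite big_mkcond/=; apply: eq_bigr => i _; rewrite inE law// fineK//.
  exact: fin_num_measure.
by rewrite prodEFin.
Qed.

Lemma mean_prod_simple (m : nat) (a : 'I_m -> R) (A : 'I_m -> set T) :
  (forall j, measurable (A j)) ->
  \int[Q]_s (\prod_(i < n) \sum_(j < m) a j * \1_(A j) (Y i s)) =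
  (\int[P]_w (\sum_(j < m) a j * \1_(A j) w)) ^+ n.
Proof.
move=> mA.
have iA j : intg P (\1_(A j)).
  apply: (intg_bounded P1 (M := 1)); first exact: measurable_indic.
  by move=> w; rewrite indicE; case: (_ \in _); rewrite ?normr1 ?normr0.
have iQ (f : {ffun 'I_n -> 'I_m}) :
    intg Q (fun s => \prod_(i < n) (\1_(A (f i)) (Y i s) : R)).
  apply: (intg_bounded Q1 (M := 1)).
    apply: measurable_prod => i _.
    by apply: measurableT_comp (measurable_sample i); exact: measurable_indic.
  move=> s; rewrite normr_prod prodr_ile1// => i _; rewrite normr_ge0 /= indicE.
  by case: (_ \in _); rewrite ?normr1 ?normr0.
have -> : (fun s => \prod_(i < n) \sum_(j < m) a j * \1_(A j) (Y i s)) =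
    (fun s => \sum_(f : {ffun 'I_n -> 'I_m})
       (\prod_(i < n) a (f i)) * \prod_(i < n) \1_(A (f i)) (Y i s)).
  apply/funext => s; rewrite bigA_distr_bigA /=.
  by apply: eq_bigr => f _; rewrite big_split.
rewrite mean_sum; last by move=> f; exact: intgZ.
rewrite mean_sum; last by move=> j; exact: intgZ.
under eq_bigr => f _ do rewrite meanZ// mean_prod_indic// -big_split/=.
rewrite -(bigA_distr_bigA (fun i j => a j * fine (P (A j)))) /=.
rewrite prodr_const card_ord; congr (_ ^+ n); apply: eq_bigr => j _.
by rewrite meanZ// mean_indic.
Qed.

(** The exponential moment method needs only an upper bound with slack, so [g] is replaced by a step
    function between [g] and [g + e], for which the product expands into indicators. *)
Lemma mean_prod_le (g : T -> R) (K e : R) : measurable_fun setT g ->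
  (forall w, 0 <= g w <= K) -> 0 < e ->
  \int[Q]_s (\prod_(i < n) g (Y i s)) <= (\int[P]_w g w + e) ^+ n.
Proof.
move=> mg gK e0.
pose m := (Num.truncn (K / e)).+1.
pose A (j : 'I_m) := [set w | e * j%:R <= g w < e * j.+1%:R].
have mA j : measurable (A j).
  have -> : A j = g @^-1` `[e * j%:R, e * j.+1%:R[%classic.
    by apply/seteqP; split => w /=; rewrite in_itv.
  by rewrite -[X in measurable X]setTI; apply: mg => //; exact: measurable_itv.
pose h w := \sum_(j < m) (e * j.+1%:R) * \1_(A j) w.
have gh w : g w <= h w <= g w + e.
  have /andP[g0 gk] := gK w.
  have ge0 : 0 <= g w / e by rewrite divr_ge0// ltW.
  have /andP[j1 j2] := truncn_itv ge0.
  have jm : (Num.truncn (g w / e) < m)%N.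
    by rewrite ltnS; apply: le_truncn; rewrite ler_wpM2r// invr_ge0 ltW.
  pose j := Ordinal jm.
  have Aj : A j w.
    rewrite /A /= mulrC -ler_pdivlMr// j1 /=.
    by rewrite [ltRHS]mulrC -ltr_pdivrMr.
  have -> : h w = e * j.+1%:R.
    rewrite /h (bigD1 j)//= indicE mem_set// mulr1 big1 ?addr0// => k kj.
    rewrite indicE memNset ?mulr0// => /andP[k1 k2].
    move/eqP: kj; apply; apply/val_inj => /=; apply/eqP.
    move: Aj => /andP[a1 a2].
    have kj1 := le_lt_trans k1 a2; have jk1 := le_lt_trans a1 k2.
    by move: kj1 jk1; rewrite !ltr_pM2l// !ltr_nat !ltnS => l1 l2; rewrite eqn_leq l1.
  move: Aj => /andP[a1 a2]; rewrite (ltW a2) /=.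
  by rewrite -natr1 mulrDr mulr1 lerD2r.
have mh : measurable_fun setT h.
  by apply: measurable_sum => j; apply: measurable_funM => //; exact: measurable_indic.
have ig : intg P g.
  by apply: (intg_bounded P1 (M := K)) => // w; have /andP[? ?] := gK w; rewrite ger0_norm.
have hb w : `|h w| <= K + e.
  have /andP[h1 h2] := gh w; have /andP[g0 gk] := gK w.
  by rewrite ger0_norm ?(le_trans g0)//; lra.
have ih : intg P h by exact: (intg_bounded P1 (M := K + e)).
have ipr (f : T -> R) M : measurable_fun setT f -> (forall w, `|f w| <= M) ->
    intg Q (fun s => \prod_(i < n) f (Y i s)).
  move=> mf fM; apply: (intg_bounded Q1 (M := M ^+ n)).
    by apply: measurable_prod => i _; exact: measurableT_comp mf (measurable_sample i).
  move=> s; rewrite normr_prod -[X in _ <= _ ^+ X]card_ord -prodr_const.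
  by apply: ler_prod => i _; rewrite normr_ge0 /=.
apply: (@le_trans _ _ (\int[Q]_s (\prod_(i < n) h (Y i s)))).
  apply: le_mean.
  - apply: (ipr g K) => // w; have /andP[? ?] := gK w; by rewrite ger0_norm.
  - exact: (ipr h (K + e)).
  - move=> s; apply: ler_prod => i _; have /andP[-> _] := gK (Y i s).
    by have /andP[-> _] := gh (Y i s).
rewrite mean_prod_simple// lerXn2r//.
- by rewrite nnegrE; apply: Rintegral_ge0 => w _; have /andP[h1 h2] := gh w;
    have /andP[g0 gk] := gK w; exact: le_trans h1.
- rewrite nnegrE; apply: addr_ge0; last exact: ltW.
  by apply: Rintegral_ge0 => w _; have /andP[] := gK w.
- rewrite -[X in _ <= _ + X](mean_cst P1) -meanD//; last exact: intg_cst.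
  apply: le_mean => //; first by apply: intgD => //; exact: intg_cst.
  by move=> w; have /andP[] := gh w.
Qed.

Definition sample_mean (f : T -> R) (s : S) : R := n%:R^-1 * \sum_(i < n) f (Y i s).

Lemma measurable_sample_mean f : measurable_fun setT f ->
  measurable_fun setT (sample_mean f).
Proof.
move=> mf; apply: measurable_funM => //; apply: measurable_sum => i.
exact: measurableT_comp mf (measurable_sample i).
Qed.

Lemma measurable_deviation f c : measurable_fun setT f ->
  measurable [set s | c <= sample_mean f s].
Proof.
move=> /measurable_sample_mean mf.
have -> : [set s | c <= sample_mean f s] = sample_mean f @^-1` `[c, +oo[%classic.
  by apply/seteqP; split => s /=; rewrite in_itv /= andbT.
by rewrite -[X in measurable X]setTI; apply: mf => //; exact: measurable_itv.
Qed.

(** Markov's inequality for [expR (s * sum Z)]. The quadratic bound on the exponential adds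
    [s * t / 2] to the exponent per sample and the slack of [mean_prod_le] adds [s * t / 4], which
    leaves [s * t / 4] of the gain [s * t]. *)
Lemma bernstein (Z : T -> R) (K s t : R) : (0 < n)%N ->
  measurable_fun setT Z -> (forall w, `|Z w| <= K) ->
  0 < s -> 0 < t -> (forall w, s * Z w <= 1 / 3) ->
  s * \int[P]_w (Z w ^+ 2) <= t / 2 ->
  (Q [set x | (\int[P]_w Z w + t <= sample_mean Z x)%R] <=
    (expR (- (n%:R * (s * t) / 4)))%:E)%E.
Proof.
move=> n0 mZ ZK s0 t0 sZ sV; set m := \int[P]_w Z w.
have st : 0 < s * t by rewrite mulr_gt0.
(* An empty [T] cannot carry mass 1, so some [Z w] exists. *)
have K0 : 0 <= K.
  have [w|T0] := pselect (exists w : T, True); last first.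
    exfalso; have := P1; rewrite (_ : setT = set0) ?measure0.
      by move/eqP; rewrite eqe eq_sym oner_eq0.
    by apply/seteqP; split => // w _; apply: T0; exists w.
  by case: w => w _; exact: le_trans (ZK w).
pose g w := expR (s * Z w).
have mg : measurable_fun setT g.
  by apply: measurableT_comp => //; exact: measurable_funM.
have gb w : 0 <= g w <= expR (1 / 3) by apply/andP; split; [exact: expR_ge0|rewrite ler_expR; exact: sZ].
have iZ : intg P Z by exact: (intg_bounded P1 (M := K)).
have iZ2 : intg P (fun w => Z w ^+ 2).
  apply: (intg_bounded P1 (M := K ^+ 2)); first exact: measurable_funX.
  by move=> w; rewrite normrX lerXn2r// nnegrE.
have ig : intg P g.
  by apply: (intg_bounded P1 (M := expR (1/3))) => // w; have /andP[? ?] := gb w; rewrite ger0_norm.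
have gle : \int[P]_w g w + s * t / 4 <= expR (s * m + 3 * (s * t) / 4).
  apply: le_trans _ (expR_ge1Dx _).
  have : \int[P]_w g w <= \int[P]_w (1 + s * Z w + s ^+ 2 * Z w ^+ 2).
    apply: le_mean => //.
      by apply: intgD; [apply: intgD; [exact: intg_cst|exact: intgZ]|exact: intgZ].
    by move=> w; rewrite -exprMn; exact: expR_le_quadratic.
  rewrite !meanD//; [|exact: intg_cst|exact: intgZ|by apply: intgD; [exact: intg_cst|exact: intgZ]|exact: intgZ].
  rewrite mean_cst// !meanZ// -/m expr2 -mulrA.
  have := ler_wpM2l (ltW s0) sV; lra.
have := mean_prod_le mg gb (_ : 0 < s * t / 4) => /(_ ltac:(lra)) pr.
set C := [set x | _].
have mC : measurable C by exact: measurable_deviation.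
pose k := expR (- (n%:R * s * (m + t))).
have iprod : intg Q (fun x => \prod_(i < n) g (Y i x)).
  apply: (intg_bounded Q1 (M := expR (1/3) ^+ n)).
    by apply: measurable_prod => i _; exact: measurableT_comp mg (measurable_sample i).
  move=> x; rewrite normr_prod -[X in _ <= _ ^+ X]card_ord -prodr_const.
  by apply: ler_prod => i _; rewrite normr_ge0 /=; have /andP[? ?] := gb (Y i x); rewrite ger0_norm.
have QC : fine (Q C) <= k * \int[Q]_x (\prod_(i < n) g (Y i x)).
  rewrite -mean_indic// -meanZ//; apply: le_mean; last first.
  - move=> x; rewrite indicE; case: (boolP (x \in C)) => [|_]; last first.
      rewrite mulr_ge0 ?expR_ge0//; apply: prodr_ge0 => i _; exact: expR_ge0.
    rewrite inE /C /= /sample_mean => h.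
    rewrite /g -expR_sum -expRD -[leLHS]expR0 ler_expR -mulr_sumr.
    move: h; rewrite ler_pdivlMl ?ltr0n// => h.
    have := ler_wpM2l (ltW s0) h; lra.
  - exact: intgZ.
  - apply: (intg_bounded Q1 (M := 1)); first exact: measurable_indic.
    by move=> w; rewrite indicE; case: (_ \in _); rewrite ?normr1 ?normr0.
rewrite -(fineK (fin_num_measure Q C mC)) lee_fin; apply: (le_trans QC).
apply: (@le_trans _ _ (k * expR (s * m + 3 * (s * t) / 4) ^+ n)).
  apply: ler_wpM2l; first exact: expR_ge0.
  apply: (le_trans pr); apply: lerXn2r => //; rewrite nnegrE.
    by rewrite addr_ge0//; [apply: Rintegral_ge0 => w _; exact: expR_ge0|lra].
  exact: expR_ge0.
rewrite /k -expRM_natl -expRD ler_expR; lra.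
Qed.

(** Meant for the duality gap: it may be unbounded, but its expectation can be made so small that
    the factor [n] of the union bound does no harm. *)
Lemma union_markov (G : T -> R) (c : R) : measurable_fun setT G ->
  (forall w, 0 <= G w) -> intg P G -> 0 < c ->
  exists E : set S, [/\ measurable E,
    (Q E <= (n%:R * (\int[P]_w G w / c))%:E)%E &
    forall s, ~ E s -> forall i, G (Y i s) < c].
Proof.
move=> mG G0 iG c0; have [_ law _] := iidY.
set C := [set w | c <= G w].
have mC : measurable C.
  have -> : C = G @^-1` `[c, +oo[%classic.
    by apply/seteqP; split => s /=; rewrite in_itv /= andbT.
  by rewrite -[X in measurable X]setTI; apply: mG => //; exact: measurable_itv.
have PC : (P C <= (\int[P]_w G w / c)%:E)%E.
  rewrite -(fineK (fin_num_measure P C mC)) lee_fin ler_pdivlMr// mulrC.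
  rewrite -mean_indic// -meanZ; last first.
    apply: (intg_bounded P1 (M := 1)); first exact: measurable_indic.
    by move=> w; rewrite indicE; case: (_ \in _); rewrite ?normr1 ?normr0.
  apply: le_mean => //.
    apply: intgZ; apply: (intg_bounded P1 (M := 1)); first exact: measurable_indic.
    by move=> w; rewrite indicE; case: (_ \in _); rewrite ?normr1 ?normr0.
  move=> w; rewrite indicE; case: (boolP (w \in C)); first by rewrite inE mulr1.
  by rewrite mulr0.
exists (\big[setU/set0]_(i < n) (Y i @^-1` C)); split; last first.
- by move=> s nE i; rewrite ltNge; apply/negP => ci; apply: nE; rewrite (bigD1 i)//=; left.
- 
apply: (@le_trans _ _ (\sum_(i < n) Q (Y i @^-1` C))%E).
  by apply: measure_bigsetU_le => i; exact: sample_preimage.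
apply: (@le_trans _ _ (\sum_(i < n) (\int[P]_w G w / c)%:E)%E).
  by apply: lee_sum => i _; rewrite law.
by rewrite sumEFin big_const_ord iter_addr_0 mulr_natl.
- by apply: bigsetU_measurable => i _; exact: sample_preimage.
Qed.

End independence.

(** * The empirical risk *)

Section empirical_integral.
Context {R : realType} {d : measure_display} {T : measurableType d}.
Variables (n : nat) (x : 'I_n -> T).
Hypothesis n0 : (0 < n)%N.

Local Notation Pn := (empirical x : {measure set T -> \bar R}).

Lemma empirical_setT : Pn setT = 1%E.
Proof.
rewrite /= /empirical; under eq_bigr do rewrite diracT.
rewrite sumEFin -EFinM big_const_ord iter_addr_0 mulVf//.
by rewrite pnatr_eq0 -lt0n.
Qed.

Lemma integral_empirical (f : T -> \bar R) : measurable_fun setT f ->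
  (forall w, 0 <= f w)%E ->
  (\int[Pn]_w f w = (n%:R^-1)%:E * \sum_(i < n) f (x i))%E.
Proof.
move=> mf f0.
(* [msum] takes a sequence indexed by [nat]; the default index only occurs for [k >= n], outside the
   sum. *)
pose m_ (k : nat) : {measure set T -> \bar R} := \d_(x (insubd (Ordinal n0) k)).
have ge0 : 0 <= (n%:R^-1 : R) by rewrite invr_ge0.
rewrite (@eq_measure_integral _ _ _ _ (mscale (NngNum ge0) (msum m_ n))); last first.
  move=> A mA _; rewrite /= /mscale /= /empirical /msum; congr (_ * _)%E.
  by apply: eq_bigr => i _; rewrite /m_ /= valKd.
rewrite ge0_integral_mscale//= ge0_integral_measure_sum//; congr (_ * _)%E.
apply: eq_bigr => i _.
by rewrite /m_ integral_dirac// diracT mul1e valKd.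
Qed.

Lemma intg_empirical (f : T -> R) : measurable_fun setT f -> intg Pn f.
Proof.
move=> mf; apply/integrableP; split; first exact/measurable_EFinP.
rewrite integral_empirical//; last first.
  by apply: measurableT_comp => //; exact/measurable_EFinP.
by under eq_bigr do rewrite /= ; rewrite sumEFin -EFinM ltry.
Qed.

Lemma mean_empirical (f : T -> R) : measurable_fun setT f ->
  \int[Pn]_w f w = n%:R^-1 * \sum_(i < n) f (x i).
Proof.
move=> mf.
have ge0E (g : T -> R) : measurable_fun setT g -> (forall w, 0 <= g w) ->
    \int[Pn]_w g w = n%:R^-1 * \sum_(i < n) g (x i).
  move=> mg g0; rewrite /Rintegral integral_empirical//.
    by rewrite sumEFin -EFinM.
  exact/measurable_EFinP.
have m1 : measurable_fun setT (fun w => `|f w|) by exact: measurableT_comp.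
have m2 : measurable_fun setT (fun w => `|f w| - f w) by exact: measurable_funB.
have -> : \int[Pn]_w f w = \int[Pn]_w (`|f w| - (`|f w| - f w)).
  by congr (Rintegral _ _ _); apply/funext => w; ring.
rewrite meanB; [|exact: intg_empirical..].
rewrite !ge0E//; last by move=> w; rewrite subr_ge0 ler_norm.
rewrite -mulrBr -sumrB; congr (_ * _); apply: eq_bigr => i _; ring.
Qed.

End empirical_integral.

Lemma convex_rel_sum (R : realType) (K : R -> R -> Prop) (I : Type) (r : seq I)
    (w x y : I -> R) :
  convex_rel K -> (forall i, 0 <= w i) -> (forall i, K (x i) (y i)) ->
  0 < \sum_(i <- r) w i ->
  K ((\sum_(i <- r) w i * x i) / \sum_(i <- r) w i)
    ((\sum_(i <- r) w i * y i) / \sum_(i <- r) w i).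
Proof.
move=> cK w0 Kxy; elim: r => [|i r IH]; first by rewrite big_nil ltxx.
rewrite !big_cons.
have : 0 <= \sum_(j <- r) w j by exact: sumr_ge0.
set W := \sum_(j <- r) w j in IH *.
set A := \sum_(j <- r) w j * x j in IH *; set C := \sum_(j <- r) w j * y j in IH *.
(* If the remaining weights all vanish, the induction hypothesis is void and the average is the
   point [i] itself. *)
rewrite le_eqVlt => /orP[/eqP W0|W0] wW.
  have [A0 C0] : A = 0 /\ C = 0.
    have : W = 0 by [].
    rewrite /W /A /C; elim: (r) => [|j s IHs]; first by rewrite !big_nil.
    rewrite !big_cons => /eqP; rewrite paddr_eq0//; last exact: sumr_ge0.
    by move=> /andP[/eqP -> /eqP/IHs[-> ->]]; rewrite !mul0r !addr0.
  have wi : w i != 0 by move: wW; rewrite -W0 addr0 => /lt0r_neq0.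
  by rewrite A0 C0 -W0 !addr0 ![w i * _]mulrC !mulfK.
have Wn : W != 0 by exact: lt0r_neq0.
have wWn : w i + W != 0 by exact: lt0r_neq0.
have t01 : 0 <= w i / (w i + W) <= 1.
  by apply/andP; split; [rewrite divr_ge0// ltW|rewrite ler_pdivrMr// mul1r lerDl ltW].
have := cK _ _ _ _ _ t01 (Kxy i) (IH W0).
by congr (K _ _); field; rewrite ?Wn ?wWn.
Qed.

Section empirical_risk.
Context {R : realType} {n : nat}.
Variables (phi : R -> \bar R) (tau : R).
Hypothesis n0 : (0 < n)%N.
Hypothesis tau0 : 0 < tau.
Hypothesis dphi : divergence_function phi.
Implicit Types (u z c : 'I_n -> R).

(** The empirical problem in finite dimension. Samples with equal values of [X] may carry different
    weights here. *)
Definition feasible_weights z c : Prop :=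
  [/\ forall i, epi phi (z i) (c i), \sum_(i < n) z i = n%:R &
      \sum_(i < n) c i <= n%:R * tau].

Definition weighted_values u :=
  [set v | exists z c, feasible_weights z c /\ v = n%:R^-1 * \sum_(i < n) u i * z i].

Definition weighted_risk u : R := sup (weighted_values u).

Lemma weighted_values_has_sup u : has_sup (weighted_values u).
Proof.
have nr : 0 < n%:R :> R by rewrite ltr0n.
split.
  exists (n%:R^-1 * \sum_(i < n) u i * 1), (fun=> 1), (fun=> 0); split => //; split.
  - by move=> i; exact: epi1.
  - by rewrite big_const_ord iter_addr_0.
  - by rewrite big1// mulr_ge0 ?ltW.
exists (n%:R^-1 * \sum_(i < n) `|u i| * n%:R) => _ [z [c [[e z1 c1] ->]]].
have z0 i : 0 <= z i by have [] := epi_ge0 dphi (e i).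
apply: ler_wpM2l; first by rewrite invr_ge0 ltW.
apply: ler_sum => i _; apply: (@le_trans _ _ (`|u i| * z i)).
  by rewrite ler_wpM2r// ler_norm.
by rewrite ler_wpM2l// -z1 (bigD1 i)//= lerDl sumr_ge0.
Qed.

(** The weights are nonnegative with average 1. The bound serves to show that the empirical risk is
    a measurable function of the samples. *)
Lemma weighted_risk_lipschitz u v e : (forall i, `|u i - v i| <= e) ->
  weighted_risk u <= weighted_risk v + e.
Proof.
have nr : 0 < n%:R :> R by rewrite ltr0n.
move=> uv; apply: ge_sup; first exact: (weighted_values_has_sup u).1.
move=> _ [z [c [f ->]]]; have [ep z1 c1] := f.
have z0 i : 0 <= z i by have [] := epi_ge0 dphi (ep i).
apply: (@le_trans _ _ (n%:R^-1 * \sum_(i < n) v i * z i + e)); last first.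
  rewrite lerD2r; apply: ub_le_sup; first exact: (weighted_values_has_sup v).2.
  by exists z, c.
have -> : e = n%:R^-1 * \sum_(i < n) e * z i.
  by rewrite -mulr_sumr z1 mulrCA mulVf ?mulr1// gt_eqF.
rewrite -mulrDr; apply: ler_wpM2l; first by rewrite invr_ge0 ltW.
rewrite -big_split/=.
apply: ler_sum => i _; have := uv i; have := ler_norm (u i - v i).
have := z0 i; nra.
Qed.

Lemma sum_class_card u t :
  \sum_(i < n) (u i == t)%:R = #|[set k | u k == t]%SET|%:R :> R.
Proof.
rewrite -sum1dep_card natr_sum [RHS]big_mkcond/=.
by apply: eq_bigr => i _; case: eqP.
Qed.

(** Exchange the sums: each [a j] is spread evenly over its class, on which [b] is constant. *)
Lemma class_average u (a b : 'I_n -> R) :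
  (forall i j, u i = u j -> b i = b j) ->
  \sum_(i < n) b i * (\sum_(j < n) (u j == u i)%:R * (a j / #|[set k | u k == u j]%SET|%:R))
  = \sum_(j < n) b j * a j.
Proof.
move=> bu.
under eq_bigr do rewrite mulr_sumr.
rewrite exchange_big/=; apply: eq_bigr => j _.
set N := #|_|.
have N0 : (0 < N)%N by apply/card_gt0P; exists j; rewrite inE.
rewrite (eq_bigr (fun i => (u i == u j)%:R * (b j * (a j / N%:R)))); last first.
  move=> i _; rewrite (eq_sym (u j)); case: eqP => [e|_]; last by rewrite !mul0r mulr0.
  by rewrite !mul1r (bu _ _ e).
rewrite -mulr_suml.
rewrite sum_class_card -/N.
by rewrite mulrCA; congr (_ * _); rewrite mulrC mulfVK// pnatr_eq0 -lt0n.
Qed.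

Context {d : measure_display} {T : measurableType d}.
Variables (X : T -> R) (x : 'I_n -> T).
Hypothesis mX : measurable_fun setT X.

Local Notation Pn := (empirical x : {measure set T -> \bar R}).

Let nr : 0 < n%:R :> R. Proof. by rewrite ltr0n. Qed.

(* A feasible density only has to be averaged over the classes of sample points
   with the same value of [X] to become a measurable function of [X]. *)
Lemma divergence_risk_empirical :
  divergence_risk phi tau Pn X = (weighted_risk (fun i => X (x i)))%:E.
Proof.
pose u i := X (x i); have hs := weighted_values_has_sup u.
have nh := nr; have ninv : 0 < n%:R^-1 :> R by rewrite invr_gt0.
have [phi0 _ _ _ _] := dphi.
have mphi zeta : measurable_fun setT zeta -> measurable_fun setT (fun w : T => phi (zeta w)).
  by move=> mz; exact: (measurableT_comp (measurable_phi dphi) mz).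
apply/eqP; rewrite eq_le; apply/andP; split.
- apply: ge_ereal_sup => _ [zeta [mz z0 m1 pt] <-].
  have -> : (\int[Pn]_w (X w * zeta w)%:E = (n%:R^-1 * \sum_(i < n) u i * zeta (x i))%:E)%E.
    rewrite -mean_EFin ?mean_empirical//; [exact: measurable_funM|].
    by apply: intg_empirical => //; exact: measurable_funM.
  rewrite lee_fin; apply: ub_le_sup; first exact: hs.2.
  (* Every sample point has positive empirical mass, so an infinite value would make the divergence
     infinite. *)
  have fin i : phi (zeta (x i)) \is a fin_num.
    rewrite ge0_fin_numE//; rewrite ltey; apply/eqP => e; move: pt.
    rewrite integral_empirical//; last exact: mphi.
    rewrite (bigD1 i)//= e addye; last first.
      by rewrite gt_eqF// (lt_le_trans (ltNyr 0))// sume_ge0.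
    by rewrite gt0_muley ?lte_fin// leye_eq.
  exists (fun i => zeta (x i)), (fun i => fine (phi (zeta (x i)))); split => //; split.
  + by move=> i; rewrite /epi fineK.
  + move: m1; rewrite -mean_EFin; last exact: intg_empirical.
    rewrite mean_empirical// => -[] h.
    by apply: (mulfI (lt0r_neq0 ninv)); rewrite h mulVf ?gt_eqF.
  + rewrite -ler_pdivrMl//; move: pt; rewrite integral_empirical//; last exact: mphi.
    rewrite (eq_bigr (fun i => (fine (phi (zeta (x i))))%:E)); last by move=> i _; rewrite fineK.
    by rewrite sumEFin -EFinM lee_fin.
- apply/lee_addgt0Pr => e e0.
  have [v [z [c [[ep z1 c1] ->]]] ev] := sup_adherent e0 hs.
  rewrite -leeBlDr// -EFinB.
  pose N j := #|[set k | u k == u j]%SET|.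
  pose wt j := (N j)%:R^-1 : R.
  have N0 j : (0 < N j)%N by apply/card_gt0P; exists j; rewrite inE.
  have wt0 j : 0 < wt j by rewrite invr_gt0 ltr0n.
  (* At values [t] that are not sampled this is 0, which the empirical measure does not see. *)
  pose avg (a : 'I_n -> R) (t : R) : R := \sum_(j < n) (u j == t)%:R * (a j / (N j)%:R).
  pose zeta w := avg z (X w).
  have z0 i : 0 <= z i by have [] := epi_ge0 dphi (ep i).
  have mz : measurable_fun setT zeta.
    apply: measurable_sum => j; apply: measurable_funM => //.
    have -> : (fun w => (u j == X w)%:R) = \1_(X @^-1` [set u j]) :> (T -> R).
      apply/funext => w; rewrite indicE; congr (_%:R); congr nat_of_bool.
      by apply/eqP/idP; rewrite inE /= => ->.
    apply: measurable_indic; rewrite -[X in measurable X]setTI; exact: mX.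
  have zeta0 w : 0 <= zeta w.
    by apply: sumr_ge0 => j _; rewrite mulr_ge0// divr_ge0.
  have wsum i : \sum_(j < n) (u j == u i)%:R * wt j = 1.
    rewrite (eq_bigr (fun j => (u j == u i)%:R * wt i)).
      rewrite -mulr_suml /wt.
      by rewrite sum_class_card -/(N i) mulfV// pnatr_eq0 -lt0n; exact: N0.
    by move=> j _; case: eqP => [e'|]; [rewrite /wt /N e'|rewrite !mul0r].
  have avgE a i : avg a (u i) = \sum_(j < n) ((u j == u i)%:R * wt j) * a j.
    by apply: eq_bigr => j _; rewrite -mulrA (mulrC (wt j)).
  have eavg i : epi phi (avg z (u i)) (avg c (u i)).
    have := @convex_rel_sum _ _ _ (index_enum 'I_n) (fun j => (u j == u i)%:R * wt j) z c
      (epi_convex dphi) _ ep.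
    rewrite wsum !divr1 !avgE; apply => //.
    by move=> j; rewrite mulr_ge0// ltW.
  have b1 a : \sum_(i < n) avg a (u i) = \sum_(i < n) a i.
    have := @class_average u a (fun=> 1) (fun _ _ _ => erefl).
    by under eq_bigr do rewrite mul1r; under [in RHS]eq_bigr do rewrite mul1r.
  apply: (@le_trans _ _ (\int[Pn]_w (X w * zeta w)%:E)%E).
    rewrite -mean_EFin ?mean_empirical//; [|exact: measurable_funM|].
      rewrite lee_fin (class_average z (b := u))//; exact: ltW.
    by apply: intg_empirical => //; exact: measurable_funM.
  apply: ereal_sup_ubound; exists zeta => //; split => //.
  + rewrite -mean_EFin; last exact: intg_empirical.
    by rewrite mean_empirical// b1 z1 mulVf// gt_eqF.
  + rewrite integral_empirical//; last exact: mphi.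
    apply: (@le_trans _ _ ((n%:R^-1)%:E * \sum_(i < n) (avg c (u i))%:E)%E).
      apply: lee_wpmul2l; first by rewrite lee_fin ltW.
      by apply: lee_sum => i _; exact: eavg.
    by rewrite sumEFin -EFinM lee_fin b1 ler_pdivrMl.
Qed.

End empirical_risk.

(** * Measurability of Lipschitz functions of the samples *)

Section lipschitz_measurable.
Context {R : realType} {dS : measure_display} {S : measurableType dS} {n : nat}.
Variables (F : ('I_n -> R) -> R) (U : 'I_n -> S -> R).
Hypothesis n0 : (0 < n)%N.
Hypothesis FL : forall u v e, (forall i, `|u i - v i| <= e) -> F u <= F v + e.
Hypothesis mU : forall i, measurable_fun setT (U i).

Let FU s := F (fun i => U i s).

(** The set is a countable union over rational points [q] of the events that the vector [U] lies
    within distance [F q - c] of [q], and on each of them the Lipschitz bound gives [c < FU]. *)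
Lemma lipschitz_measurable_gt c : measurable [set s | c < FU s].
Proof.
pose q (f : {ffun 'I_n -> rat}) i : R := ratr (f i).
pose A (f : {ffun 'I_n -> rat}) :=
  \bigcap_(i in [set: 'I_n]) [set s | `|U i s - q f i| < F (q f) - c].
have -> : [set s | c < FU s] = \bigcup_f A f.
  apply/seteqP; split => s /=.
  - move=> cF; pose e := (FU s - c) / 2.
    have e0 : 0 < e by rewrite /e; lra.
    have /choice[f fP] : forall i, exists r : rat, `|U i s - ratr r| < e.
      move=> i; have /rat_in_itvoo[r] : U i s - e < U i s + e by lra.
      rewrite in_itv /= => /andP[r1 r2]; exists r.
      by rewrite ltr_norml; apply/andP; split; lra.
    have FqE : F (fun i => U i s) <= F (q (finfun f)) + e.
      by apply: FL => i; rewrite /q ffunE ltW.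
    exists (finfun f) => // i _ /=; rewrite /q ffunE; apply: lt_le_trans (fP i) _.
    by rewrite -/(q (finfun f)) /e; move: FqE; rewrite -/(FU s) /e; lra.
  - move=> [f _ Af].
    (* The initial value is itself one of the distances, so the strict bound passes to the
       maximum. *)
    pose M := \big[Num.max/`|U (Ordinal n0) s - q f (Ordinal n0)|]_(i < n) `|U i s - q f i|.
    have Mc : M < F (q f) - c.
      by apply/bigmax_ltP; split => [|i _]; exact: Af.
    have : F (q f) <= F (fun i => U i s) + M.
      by apply: FL => i; rewrite distrC; apply: (le_bigmax_cond _ (fun i => `|U i s - q f i|)).
    by rewrite /FU; lra.
apply: countable_bigcupT_measurable; first exact: countableP.
move=> f.
apply: fin_bigcap_measurable => // i _.
have -> : [set s | `|U i s - q f i| < F (q f) - c] =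
   (fun s => `|U i s - q f i|) @^-1` `]-oo, F (q f) - c[%classic.
  by apply/seteqP; split => s /=; rewrite in_itv.
rewrite -[X in measurable X]setTI.
have mN : measurable_fun setT (fun s => `|U i s - q f i|).
  by apply: measurableT_comp => //; exact: measurable_funB.
by apply: mN => //; exact: measurable_itv.
Qed.

End lipschitz_measurable.

(** * Bounds in terms of the sample size *)

Section scale_bounds.
Context {R : realType}.
Variables (phi : R -> \bar R) (tau B eps : R).
Hypothesis dphi : divergence_function phi.
Hypothesis sphi : superlinear phi.
Hypothesis tau0 : 0 < tau.
Hypothesis eps0 : 0 < eps.
Hypothesis epsB : eps <= B.

Local Notation L := (Lval phi B tau).
Local Notation S := (sup [set Mval phi B tau e * e | e in `[eps, B]]).

Lemma Lval_ge1 e : 1 <= L e.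
Proof. exact: growth_inv_ge1. Qed.

Lemma Mval_le_sup e : eps <= e <= B -> (3 + 2 * L e) * B * e <= S.
Proof.
move=> /andP[e1 e2]; have h0 := eps0; have h1 := tau0; have h2 := epsB.
have B0 : 0 < B by lra.
apply: ub_le_sup; last by exists e => //=; rewrite in_itv /= e1 e2.
(* The set is bounded above because [L e] is nonincreasing in [e]. *)
exists (Mval phi B tau eps * B); move=> v [e' he <-]; move: he.
rewrite /= in_itv /= => /andP[e'1 e'2].
have e'0 : 0 < e' by lra.
have Lle : L e' <= L eps.
  apply: (growth_inv_le sphi); apply: ler_wpM2l; first by rewrite !mulr_ge0 ?ltW.
  by rewrite lef_pV2.
have := Lval_ge1 e'; rewrite /Mval => L1.
apply: ler_pM; rewrite ?mulr_ge0//; try lra.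
by apply: ler_wpM2r; lra.
Qed.

Lemma sup_ge_sqr : 5 * B ^+ 2 <= S.
Proof.
have h0 := eps0; have h2 := epsB.
have := Mval_le_sup (_ : eps <= B <= B); rewrite epsB lexx => /(_ isT).
have B2 : 0 <= B ^+ 2 by exact: sqr_ge0.
have := ler_wpM2r B2 (Lval_ge1 B); rewrite !expr2; lra.
Qed.

Lemma Lval_le_sup e : eps <= e <= B -> 2 * B * L e * e <= S.
Proof.
move=> eB; have := Mval_le_sup eB; have h0 := eps0; move/andP: eB => [e1 e2].
have : 0 <= B * e by rewrite mulr_ge0; lra.
lra.
Qed.

(** Up to [L B] the scale [B] gives the first term. Beyond it, a scale [e] with [z <= L e] and
    [y = 4 * B * tau / e] at most [2 * c / z] gives the second: multiply [2 * B * z * e <= S] by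
    [y * z <= 2 * c]. *)
Lemma sqr_le_sup z c : z <= L eps -> epi phi z c ->
  4 * B ^+ 2 * z ^+ 2 <= 2 * S * z + S * (c / tau).
Proof.
move=> zL ep; have [z0 c0] := epi_ge0 dphi ep.
have h0 := eps0; have h1 := tau0; have h2 := epsB.
have B0 : 0 < B by lra.
have S5 := sup_ge_sqr; have B2 : 0 <= B ^+ 2 by exact: sqr_ge0.
have S0 : 0 <= S by lra.
have ct : 0 <= c / tau by rewrite divr_ge0// ltW.
have Sct : 0 <= S * (c / tau) by rewrite mulr_ge0.
have Sz : 0 <= S * z by rewrite mulr_ge0.
have [zB|Bz] := lerP z (L B).
  have LB : 2 * B * L B * B <= S by apply: Lval_le_sup; rewrite epsB lexx.
  have : 4 * B ^+ 2 * z ^+ 2 <= 2 * S * z.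
    have h := ler_wpM2r z0 LB.
    have h' : B ^+ 2 * z * z <= B ^+ 2 * z * L B by rewrite ler_wpM2l// mulr_ge0.
    rewrite !expr2 in h' *; lra.
  lra.
suff : 4 * B ^+ 2 * z ^+ 2 <= S * (c / tau) by lra.
have z1 : 1 <= z by exact: le_trans (Lval_ge1 B) (ltW Bz).
have := epi_growth_inv sphi Bz ep.
have -> : 4 * B * tau / B * z = 4 * tau * z by field; rewrite gt_eqF.
move=> czt.
have c00 : 0 < c by nra.
have zp : 0 < z by lra.
(* The factor 2 makes [c < y * z] strict, as [le_growth_inv] demands. The second argument keeps
   [e >= eps], and [4 * tau <= y] keeps [e <= B]. *)
pose y := Num.min (2 * c / z) (4 * B * tau / eps).
have y4 : 4 * tau <= y.
  rewrite le_min ler_pdivlMr// ler_pdivlMr//; apply/andP; split; first lra.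
  by rewrite mulrAC; apply: ler_wpM2r; lra.
have y0 : 0 < y by lra.
have yc : y <= 2 * c / z by rewrite ge_min lexx.
pose e := 4 * B * tau / y.
have BT : 0 < 4 * B * tau by rewrite !mulr_gt0.
have e0 : 0 < e by rewrite divr_gt0.
have eE : 4 * B * tau / e = y by rewrite /e invf_div mulrCA mulfV ?mulr1// gt_eqF.
have eB : eps <= e <= B.
  rewrite /e ler_pdivlMr// ler_pdivrMr//; apply/andP; split.
    by rewrite -ler_pdivlMl// mulrC ge_min lexx orbT.
  by have := ler_wpM2l (ltW B0) y4; lra.
have zLe : z <= L e.
  rewrite /Lval eE /y; have [_|//] := leP (2 * c / z) (4 * B * tau / eps).
  by apply: (le_growth_inv sphi z1 ep); rewrite mulfVK ?gt_eqF//; lra.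
have h3 := Lval_le_sup eB.
have ye : y * e = 4 * B * tau by rewrite /e mulrC mulfVK// gt_eqF.
have yz : y * z <= 2 * c by rewrite -ler_pdivlMr.
have h4 : 2 * B * z * e <= S.
  by apply: le_trans h3; apply: ler_wpM2r; [exact: ltW|apply: ler_wpM2l => //; lra].
rewrite [S * (c / tau)]mulrA ler_pdivlMr//.
have h5 : 2 * B * z * e * (y * z) <= S * (2 * c).
  apply: ler_pM; [|by apply: mulr_ge0; exact: ltW|exact: h4|exact: yz].
  apply: mulr_ge0; last exact: ltW.
  by apply: mulr_ge0 => //; lra.
have e1 : 2 * B * z * e * (y * z) = 2 * B * z * z * (y * e) by ring.
rewrite e1 ye in h5; rewrite !expr2; lra.
Qed.

(** The argument of the logarithm exceeds [5 / delta], because [eps <= B] and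
    [(2 + tau) ^+ 2 >= 8 * tau]. This serves five exceptional events of probability [delta / 5]
    each. *)
Lemma log_term_bound (delta : R) : 0 < delta < 1 ->
  0 < log_term phi B tau eps delta /\ expR (- log_term phi B tau eps delta) <= delta / 5.
Proof.
move=> /andP[d0 d1]; have h0 := eps0; have h1 := tau0; have h2 := epsB.
have B0 : 0 < B by lra.
have L1 := Lval_ge1 eps.
have lb : 2 + tau <= Lbar phi B tau eps.
  have : 0 <= 2 * L eps * B / lambda_low tau eps.
    rewrite /lambda_low divr_ge0//; first by rewrite !mulr_ge0; lra.
    by rewrite divr_ge0//; lra.
  by rewrite /Lbar; lra.
rewrite /log_term; set A := (X in ln X); have Ab : 5 / delta <= A.
  rewrite /A ler_pdivlMr; last by rewrite !mulr_gt0// exprn_gt0.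
  have -> : 5 / delta * (eps ^+ 2 * tau * delta) = 5 * (eps ^+ 2 * tau).
    by field; lra.
  have q1 : eps ^+ 2 <= B ^+ 2 by rewrite lerXn2r// nnegrE ltW.
  have q2 : 8 * tau <= Lbar phi B tau eps ^+ 2.
    apply: (@le_trans _ _ ((2 + tau) ^+ 2)).
      have := sqr_ge0 (tau - 2); rewrite !expr2; lra.
    by rewrite lerXn2r// nnegrE; lra.
  have q3 : eps ^+ 2 * (8 * tau) <= B ^+ 2 * Lbar phi B tau eps ^+ 2.
    by apply: ler_pM => //; [exact: sqr_ge0|lra].
  have : 0 <= eps ^+ 2 * tau by rewrite mulr_ge0 ?sqr_ge0// ltW.
  lra.
have d5 : 0 < 5 / delta by rewrite divr_gt0.
have A0 : 0 < A by exact: lt_le_trans Ab.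
have A1 : 1 < A by apply: lt_le_trans Ab; rewrite ltr_pdivlMr//; lra.
split; first by rewrite ln_gt0.
rewrite expRN lnK ?posrE//.
by rewrite -[delta / 5]invrK [(delta / 5)^-1]invf_div lef_pV2 ?posrE.
Qed.

End scale_bounds.

(** * Concentration *)

Section concentration.
Context {R : realType} {d dS : measure_display}
  {T : measurableType d} {S : measurableType dS}.
Variables (phi : R -> \bar R) (tau B eps delta : R).
Variables (P : probability T R) (X : T -> R) (n : nat).
Variables (Q : probability S R) (Y : 'I_n -> S -> T).
Hypothesis dphi : divergence_function phi.
Hypothesis sphi : superlinear phi.
Hypothesis tau0 : 0 < tau.
Hypothesis mX : measurable_fun setT X.
Hypothesis XB : forall w, - B <= X w <= B.
Hypothesis eps0 : 0 < eps.
Hypothesis epsB : eps <= B.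
Hypothesis delta0 : 0 < delta.
Hypothesis iidY : iid_samples P Q Y.
Hypothesis n0 : (0 < n)%N.

Local Notation L := (Lval phi B tau eps).
Local Notation SM := (sup [set Mval phi B tau e * e | e in `[eps, B]]).
Local Notation X' := (fun w => X w + B).

Hypothesis n_large : expR (- (n%:R * (eps / (64 * SM) * (eps / 8)) / 4)) <= delta / 5.

Let P1 : P setT = 1%E. Proof. exact: probability_setT. Qed.
Let B0 : 0 < B. Proof. exact: lt_le_trans epsB. Qed.
Let L1 : 1 <= L. Proof. exact: Lval_ge1. Qed.
Let mX' : measurable_fun setT X'. Proof. exact: measurable_shift. Qed.
Let Xb : forall w, 0 <= X' w <= 2 * B. Proof. exact: shift_bounds. Qed.
Let SB : 5 * B ^+ 2 <= SM. Proof. exact: (sup_ge_sqr sphi). Qed.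
Let B2 : 0 < B ^+ 2. Proof. by rewrite exprn_gt0. Qed.
Let SM0 : 0 < SM. Proof. by have := SB; have := B2; lra. Qed.
Let SL : 2 * B * L * eps <= SM.
Proof. by apply: (Lval_le_sup sphi) => //; rewrite lexx epsB. Qed.

Definition unlikely_above (Z : T -> R) : Prop :=
  exists E : set S, [/\ measurable E, (Q E <= (delta / 5)%:E)%E &
    forall s, ~ E s -> sample_mean Y Z s < \int[P]_w Z w + eps / 8].

(** Bernstein's inequality with [s = eps / (64 * SM)] and [t = eps / 8]: the second moment gives
    [s * (4 * SM) = t / 2], and [SL] gives [s * Z <= 1 / 64]. *)
Lemma bounded_unlikely_above (Z : T -> R) :
  measurable_fun setT Z -> (forall w, `|Z w| <= 2 * B * L) ->
  \int[P]_w (Z w ^+ 2) <= 4 * SM -> unlikely_above Z.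
Proof.
move=> mZ ZK Z2; have h0 := eps0; have S0 := SM0; have h1 := SL.
exists [set s | \int[P]_w Z w + eps / 8 <= sample_mean Y Z s]; split.
- exact: (measurable_deviation iidY _ mZ).
- apply: le_trans (_ : ((expR (- (n%:R * (eps / (64 * SM) * (eps / 8)) / 4)))%:E <= _)%E);
    last by rewrite lee_fin; exact: n_large.
  apply: (bernstein iidY n0 mZ ZK); first by rewrite divr_gt0// mulr_gt0.
  + by lra.
  + move=> w; rewrite mulrAC ler_pdivrMr ?mulr_gt0//.
    have ZL : Z w <= 2 * B * L := le_trans (ler_norm _) (ZK w).
    have := ler_wpM2l (ltW eps0) ZL; lra.
  + rewrite mulrAC ler_pdivrMr ?mulr_gt0//.
    have := ler_wpM2l (ltW eps0) Z2; lra.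
- by move=> s /= /negP; rewrite -ltNge.
Qed.

Section saddle.
Variables (lam nu : R) (zeta psi : T -> R).
Hypothesis lam0 : 0 < lam.
Hypothesis nub : 0 <= nu <= 2 * B.
Hypothesis pl : play phi L P zeta psi.
Hypothesis m1 : \int[P]_w zeta w = 1.
Hypothesis Epsi : \int[P]_w psi w <= tau.

Local Notation f := (tconj phi L nu lam).

(** The slack in Young's inequality at [w]. *)
Definition dual_gap w := f (X' w) - ((X' w - nu) * zeta w - lam * psi w).

Hypothesis Egap : \int[P]_w dual_gap w <= eps / 2.

Let mz : measurable_fun setT zeta. Proof. by case: pl. Qed.
Let ipsi : intg P psi. Proof. by case: pl. Qed.
Let iz : intg P zeta. Proof. exact: play_intg pl. Qed.
Let izX : intg P (fun w => X' w * zeta w). Proof. exact: play_intgX pl. Qed.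
Let mf : measurable_fun setT (fun w => f (X' w)).
Proof. exact: (measurable_tconjX _ dphi L1 (ltW lam0)). Qed.
Let iif : intg P (fun w => f (X' w)).
Proof. exact: (intg_tconj _ dphi L1 (ltW lam0) P1 mX' Xb). Qed.

Lemma intg_lagrangian : intg P (fun w => (X' w - nu) * zeta w - lam * psi w).
Proof.
have -> : (fun w => (X' w - nu) * zeta w - lam * psi w) =
    (fun w => X' w * zeta w - nu * zeta w - lam * psi w).
  by apply/funext => w; ring.
by apply: intgB; [apply: intgB => //|]; exact: intgZ.
Qed.

Lemma intg_dual_gap : intg P dual_gap.
Proof. by apply: intgB => //; exact: intg_lagrangian. Qed.

Lemma dual_gap_ge0 w : 0 <= dual_gap w.
Proof.
by rewrite subr_ge0; have [_ _ zL ep] := pl; exact: (tconj_ge _ dphi L1 (ltW lam0)).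
Qed.

(** The majorant from [sqr_le_sup], with expectation at most [2 * SM + SM]. *)
Let V w := 2 * SM * zeta w + SM / tau * psi w.

Let iV : intg P V. Proof. by apply: intgD; exact: intgZ. Qed.

Let EV : \int[P]_w V w <= 3 * SM.
Proof.
rewrite meanD; [|exact: intgZ..]; rewrite !meanZ// m1 mulr1.
have h : SM / tau * \int[P]_w psi w <= SM / tau * tau.
  by rewrite ler_wpM2l// divr_ge0// ltW.
rewrite mulfVK ?gt_eqF// in h; apply: le_trans (lerD (lexx _) h) _.
lra.
Qed.

Let sqr_zeta w : 4 * B ^+ 2 * zeta w ^+ 2 <= V w.
Proof.
have [_ _ zL ep] := pl.
apply: (le_trans (sqr_le_sup dphi sphi tau0 eps0 epsB (zL w) (ep w))).
by rewrite /V (_ : SM * (psi w / tau) = SM / tau * psi w)//; ring.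
Qed.

Let sqr_mul_zeta w u : 0 <= u <= 2 * B -> (u * zeta w) ^+ 2 <= V w.
Proof.
move=> /andP[u0 u2]; apply: le_trans (sqr_zeta w).
rewrite exprMn ler_wpM2r ?sqr_ge0// (_ : 4 * B ^+ 2 = (2 * B) ^+ 2); last ring.
by rewrite lerXn2r// nnegrE mulr_ge0// ltW.
Qed.

(** Beyond [V], the target [4 * SM] leaves room [SM] for a correction [g]. *)
Let mean_sqr_le (Z g : T -> R) :
  measurable_fun setT Z -> (forall w, `|Z w| <= 2 * B * L) ->
  intg P g -> \int[P]_w g w <= SM -> (forall w, Z w ^+ 2 <= V w + g w) ->
  \int[P]_w (Z w ^+ 2) <= 4 * SM.
Proof.
move=> mZ ZK ig gS Z2.
have K0 : 0 <= 2 * B * L.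
  by rewrite !mulr_ge0// ?(ltW B0)// (le_trans _ L1).
apply: (@le_trans _ _ (\int[P]_w (V w + g w))).
  apply: le_mean => //; last exact: intgD.
  apply: (intg_bounded P1 (M := (2 * B * L) ^+ 2)); first exact: measurable_funX.
  by move=> w; rewrite normrX lerXn2r// nnegrE.
rewrite meanD//; apply: le_trans (lerD EV gS) _; lra.
Qed.

Let zb w : 0 <= zeta w <= L.
Proof. by have [q1 q2 _] := play_bounds dphi w pl; rewrite q1. Qed.

Let mul_zeta_bounds w u : 0 <= u <= 2 * B -> 0 <= u * zeta w <= 2 * B * L.
Proof.
move=> /andP[u0 u2]; have /andP[z0 zL] := zb w.
by rewrite mulr_ge0//= ler_pM.
Qed.

(* [f (X' w) - f 0] is at most [X' w * zeta w], up to the duality gap, since [zeta]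
   is nearly a subgradient of the convex function [f] at [X' w]. *)
Lemma dual_unlikely_above : unlikely_above (fun w => f (X' w) - f 0).
Proof.
have fb w : f 0 <= f (X' w) <= f 0 + L * (2 * B).
  exact: (tconj_bounds _ dphi L1 (ltW lam0) Xb).
pose h w := f (X' w) - f 0.
have hb w : 0 <= h w <= 2 * B * L.
  by have /andP[q1 q2] := fb w; rewrite /h; apply/andP; split; lra.
have mh : measurable_fun setT h by exact: measurable_funB.
have hK w : `|h w| <= 2 * B * L by have /andP[q1 q2] := hb w; rewrite ger0_norm.
apply: bounded_unlikely_above => //.
apply: (@mean_sqr_le h (fun w => 4 * B * L * dual_gap w)) => //.
- by apply: intgZ; exact: intg_dual_gap.
- rewrite meanZ; last exact: intg_dual_gap.
  apply: le_trans SL.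
  apply: (@le_trans _ _ (4 * B * L * (eps / 2))).
    by rewrite ler_wpM2l// !mulr_ge0// ?(ltW B0)// (le_trans _ L1).
  by lra.
- move=> w; have /andP[q1 q2] := hb w; have g0 := dual_gap_ge0 w.
  have [_ _ zL ep] := pl.
  have hle : h w <= X' w * zeta w + dual_gap w.
    have := tconj_ge nu dphi L1 (ltW lam0) 0 (zL w) (ep w).
    by rewrite /h /dual_gap; lra.
  have k2 := sqr_mul_zeta w (Xb w).
  have k3 : h w * dual_gap w <= 2 * B * L * dual_gap w by rewrite ler_wpM2r.
  have k4 : h w * h w <= h w * (X' w * zeta w + dual_gap w) by rewrite ler_wpM2l.
  (* Write [a] for [X' * zeta]. Then [h ^+ 2 <= h * (a + gap)] and [2 * h * a <= h ^+ 2 + a ^+ 2]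
     yield [h ^+ 2 <= a ^+ 2 + 2 * h * gap]. *)
  have := sqr_ge0 (h w - X' w * zeta w).
  move: (h w) (X' w * zeta w) (dual_gap w) (V w) (B * L) k2 k3 k4 => a1 a2 a3 a4 a5.
  by rewrite -!(mulrA _ B) !expr2; lra.
Qed.

Lemma objective_unlikely_below : unlikely_above (fun w => -1 * (X' w * zeta w)).
Proof.
have mh : measurable_fun setT (fun w => -1 * (X' w * zeta w)).
  by apply: measurable_funM => //; exact: measurable_funM.
have hK w : `|-1 * (X' w * zeta w)| <= 2 * B * L.
  by have /andP[q1 q2] := mul_zeta_bounds w (Xb w); rewrite mulN1r normrN ger0_norm.
apply: bounded_unlikely_above => //.
apply: (@mean_sqr_le _ (fun=> 0)) => //; [exact: intg_cst|by rewrite mean_cst// ltW|].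
by move=> w; rewrite mulN1r sqrrN addr0; exact: sqr_mul_zeta.
Qed.

(** Normalising [zeta] under the sample costs [2 * B] times its excess mass. This one function
    controls that cost and the objective together. *)
Lemma mass_unlikely_above : unlikely_above (fun w => (2 * B - X' w) * zeta w).
Proof.
have mh : measurable_fun setT (fun w => (2 * B - X' w) * zeta w).
  by apply: measurable_funM => //; exact: measurable_funB.
have xb w : 0 <= 2 * B - X' w <= 2 * B.
  by have /andP[q1 q2] := Xb w; rewrite subr_ge0 q2 /= gerBl.
have hK w : `|(2 * B - X' w) * zeta w| <= 2 * B * L.
  by have /andP[q1 q2] := mul_zeta_bounds w (xb w); rewrite ger0_norm.
apply: bounded_unlikely_above => //.
apply: (@mean_sqr_le _ (fun=> 0)) => //; [exact: intg_cst|by rewrite mean_cst// ltW|].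
by move=> w; rewrite addr0; exact: sqr_mul_zeta.
Qed.

(* Unlike [lam * psi w], which it approximates from below up to the duality gap,
   this is bounded. *)
Definition bounded_divergence w := Num.max ((X' w - nu) * zeta w - f (X' w)) 0.

Lemma bounded_divergence_bounds w :
  bounded_divergence w <= lam * psi w <= bounded_divergence w + dual_gap w.
Proof.
have [q1 q2 q3] := play_bounds dphi w pl; have g0 := dual_gap_ge0 w.
have e1 : lam * psi w = (X' w - nu) * zeta w - f (X' w) + dual_gap w.
  by rewrite /dual_gap; ring.
apply/andP; split.
  by rewrite ge_max e1 lerDl g0 -e1 mulr_ge0// ltW.
by rewrite e1 lerD2r le_max lexx.
Qed.

Lemma measurable_bounded_divergence : measurable_fun setT bounded_divergence.
Proof.
apply: measurable_maxr => //; apply: measurable_funB => //.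
by apply: measurable_funM => //; exact: measurable_funB.
Qed.

(** The choice [z = 1] in the conjugate gives [f (X') >= X' - nu], so the divergence term is at most
    [(X' - nu) * (zeta - 1)] or 0. *)
Let bounded_divergence_le w :
  0 <= bounded_divergence w <= 2 * B * Num.max (zeta w) 1.
Proof.
have /andP[q1 q2] := zb w; have /andP[x0 x1] := Xb w; have /andP[n0' n1] := nub.
have B2' : 0 <= 2 * B by rewrite mulr_ge0// ltW.
rewrite /bounded_divergence le_max lexx orbT /= ge_max; apply/andP; split; last first.
  by rewrite mulr_ge0// le_max ler01 orbT.
have fx := tconj_ge_sub nu dphi L1 (ltW lam0) (X' w).
apply: (@le_trans _ _ ((X' w - nu) * (zeta w - 1))).
  by rewrite mulrBr mulr1 lerD2l lerN2.
apply: (@le_trans _ _ (`|X' w - nu| * `|zeta w - 1|)).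
  by rewrite -normrM ler_norm.
apply: ler_pM => //.
  by rewrite ler_norml; apply/andP; split; lra.
by rewrite ler_norml; case: (leP (zeta w) 1) => q; apply/andP; split; lra.
Qed.

Let bounded_divergence_norm w : `|bounded_divergence w| <= 2 * B * L.
Proof.
have /andP[q0 q] := bounded_divergence_le w; rewrite ger0_norm//; apply: (le_trans q).
have /andP[_ zL] := zb w.
by rewrite ler_wpM2l// ?mulr_ge0// ?(ltW B0)// ge_max zL.
Qed.

Lemma intg_bounded_divergence : intg P bounded_divergence.
Proof.
exact: (intg_bounded P1 measurable_bounded_divergence bounded_divergence_norm).
Qed.

Lemma divergence_unlikely_above : unlikely_above bounded_divergence.
Proof.
have mU := measurable_bounded_divergence.
apply: bounded_unlikely_above => //.
apply: (@mean_sqr_le _ (fun=> 4 * B ^+ 2)) => //; first exact: intg_cst.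
  by rewrite mean_cst//; have := SB; have := B2; lra.
move=> w; have /andP[q1 q2] := bounded_divergence_le w; have k1 := sqr_zeta w.
have /andP[z0 _] := zb w; have b2 := B2.
apply: (@le_trans _ _ ((2 * B * Num.max (zeta w) 1) ^+ 2)).
  by rewrite lerXn2r// nnegrE//; exact: le_trans q2.
rewrite exprMn (_ : (2 * B) ^+ 2 = 4 * B ^+ 2); last ring.
apply: (@le_trans _ _ (4 * B ^+ 2 * zeta w ^+ 2 + 4 * B ^+ 2)); last by rewrite lerD2r.
rewrite -[X in _ + X]mulr1 -mulrDr ler_wpM2l//.
  by rewrite mulr_ge0// ltW.
by case: (leP (zeta w) 1) => q; rewrite ?expr1n ?lerDr ?lerDl ?sqr_ge0.
Qed.

End saddle.

End concentration.

(** * The deviation event and the conclusion *)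

(** Outside five exceptional events, the empirical risk exceeds the risk by at most
    [eps / 3 + eps / 8 + eps / 2] and falls below it by at most
    [eps / 2 + eps / 6 + eps / 8 + eta]. *)
Lemma risk_deviation_event (R : realType) (d dS : measure_display)
    (T : measurableType d) (S : measurableType dS)
    (phi : R -> \bar R) (tau B eps delta : R) (P : probability T R) (X : T -> R)
    (n : nat) (Q : probability S R) (Y : 'I_n -> S -> T)
    (SM := sup [set Mval phi B tau e * e | e in `[eps, B]]) :
  divergence_function phi -> superlinear phi -> 0 < tau ->
  measurable_fun setT X -> (forall w, - B <= X w <= B) ->
  0 < eps -> eps <= B -> 0 < delta -> iid_samples P Q Y -> (0 < n)%N ->
  expR (- (n%:R * (eps / (64 * SM) * (eps / 8)) / 4)) <= delta / 5 ->
  exists E : set S, [/\ measurable E, (Q E <= delta%:E)%E &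
  forall s, ~ E s ->
    `| divergence_risk phi tau P X
       - divergence_risk phi tau (empirical (fun i => Y i s)) X | <= eps%:E]%E.
Proof.
move=> dphi sphi tau0 mX XB eps0 epsB delta0 iidY n0 n_large; have h0 := eps0.
pose X' w := X w + B; pose L := Lval phi B tau eps.
have P1 : P setT = 1%E by exact: probability_setT.
have B0 : 0 < B by exact: lt_le_trans epsB.
have L1 : 1 <= L by exact: Lval_ge1.
have mX' : measurable_fun setT X' by exact: measurable_shift.
have Xb w : 0 <= X' w <= 2 * B := shift_bounds XB w.
have nr : 0 < n%:R :> R by rewrite ltr0n.
pose y := 4 * B * tau / eps.
have y0 : 0 < y by rewrite divr_gt0// !mulr_gt0.
have yE : 2 * B * tau / y = eps / 2.
  by rewrite /y; field; rewrite !gt_eqF.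
have a0 : 0 < eps / 6 by clear - h0; lra.
have [lam [nu [D [lam0 nub Dr DK near]]]] :=
  approximate_saddle_point dphi L1 P1 mX' Xb tau0 a0.
have /andP[nu0 nu2] := nub.
pose c := eps / 100.
have c0 : 0 < c by rewrite /c; clear - h0; lra.
(* The second argument makes the union bound for the duality gap at threshold [c] equal to
   [delta / 5]. *)
pose eta := Num.min c (c * (delta / (5 * n%:R))).
have eta0 : 0 < eta by rewrite lt_min c0 mulr_gt0// divr_gt0// mulr_gt0.
have etac : eta <= c by rewrite ge_min lexx.
have [zeta [psi [pl m1 zr zD pa]]] := near _ eta0.
have [mz ipsi zL ep] := pl; have mpsi := intg_measurable ipsi.
pose f := tconj phi L nu lam.
have iif : intg P (fun w => f (X' w)) := intg_tconj nu dphi L1 (ltW lam0) P1 mX' Xb.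
have mf : measurable_fun setT (fun w => f (X' w)) := measurable_tconjX nu dphi L1 (ltW lam0) mX'.
have Ef : \int[P]_w f (X' w) <= D - nu - lam * tau.
  exact: (mean_tconj_le dphi L1 (ltW lam0) P1 mX' Xb).
pose gap := dual_gap phi tau B eps X lam nu zeta psi.
have gap0 w : 0 <= gap w by exact: (dual_gap_ge0 _ dphi sphi _ lam0 pl).
have igap : intg P gap by exact: (intg_dual_gap dphi sphi mX XB _ lam0 pl).
have Egap : \int[P]_w gap w <= eta.
  rewrite (meanB iif (intg_lagrangian dphi mX XB lam nu pl)).
  by rewrite lerBlDr; apply: (le_trans Ef); rewrite -lerBlDl.
have Epsi : \int[P]_w psi w <= tau.
  rewrite -subr_ge0 -(pmulr_rge0 _ lam0); apply: le_trans pa.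
  by clear - etac h0; rewrite /c in etac; lra.
have Egap2 : \int[P]_w gap w <= eps / 2.
  by apply: (le_trans Egap); clear - etac h0; rewrite /c in etac; lra.
pose U := bounded_divergence phi tau B eps X lam nu zeta.
have Ub w : U w <= lam * psi w <= U w + gap w.
  exact: (bounded_divergence_bounds _ dphi sphi _ lam0 pl).
have iU : intg P U by exact: (intg_bounded_divergence dphi sphi mX XB eps0 epsB lam0 nub pl).
have [E1 [mE1 QE1 E1P]] := dual_unlikely_above dphi sphi tau0 mX XB eps0 epsB
  iidY n0 n_large lam0 pl m1 Epsi Egap2.
have [E2 [mE2 QE2 E2P]] := objective_unlikely_below dphi sphi tau0 mX XB eps0 epsB
  iidY n0 n_large pl m1 Epsi.
have [E3 [mE3 QE3 E3P]] := mass_unlikely_above dphi sphi tau0 mX XB eps0 epsB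
  iidY n0 n_large pl m1 Epsi.
have [E4 [mE4 QE4 E4P]] := divergence_unlikely_above dphi sphi tau0 mX XB eps0 epsB
  iidY n0 n_large lam0 nub pl m1 Epsi.
have [E5 [mE5 QE5 E5P]] := union_markov iidY (intg_measurable igap) gap0 igap c0.
have QE5' : (Q E5 <= (delta / 5)%:E)%E.
  apply: (le_trans QE5); rewrite lee_fin.
  have : \int[P]_w gap w / c <= delta / (5 * n%:R).
    by rewrite ler_pdivrMr// mulrC; apply: (le_trans Egap); rewrite ge_min lexx orbT.
  move=> /(ler_wpM2l (ltW nr)) /le_trans; apply.
  by rewrite le_eqVlt; apply/orP; left; apply/eqP; field; rewrite gt_eqF.
exists (E1 `|` E2 `|` E3 `|` E4 `|` E5); split.
- by repeat apply: measurableU.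
- have -> : delta = delta / 5 + delta / 5 + delta / 5 + delta / 5 + delta / 5 by field.
  rewrite !EFinD.
  apply: le_trans (measureU2 _ _ mE5) _; first by repeat apply: measurableU.
  apply: leeD => //.
  apply: le_trans (measureU2 _ _ mE4) _; first by repeat apply: measurableU.
  apply: leeD => //.
  apply: le_trans (measureU2 _ _ mE3) _; first by repeat apply: measurableU.
  apply: leeD => //.
  by apply: le_trans (measureU2 _ mE1 mE2) _; exact: leeD.
move=> s nE.
have nE1 : ~ E1 s by move=> h; apply: nE; do 4 left.
have nE2 : ~ E2 s by move=> h; apply: nE; do 3 left; right.
have nE3 : ~ E3 s by move=> h; apply: nE; do 2 left; right.
have nE4 : ~ E4 s by move=> h; apply: nE; left; right.
have nE5 : ~ E5 s by move=> h; apply: nE; right.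
have {E1P} k1 := E1P _ nE1; have {E2P} k2 := E2P _ nE2; have {E3P} k3 := E3P _ nE3.
have {E4P} k4 := E4P _ nE4; have {E5P} k5 := E5P _ nE5.
pose x i := Y i s.
pose Pn := empirical x : {measure set T -> \bar R}.
have Pn1 : Pn setT = 1%E := empirical_setT x n0.
have smE g : measurable_fun setT g -> sample_mean Y g s = \int[Pn]_w g w.
  by move=> mg; rewrite mean_empirical.
have iPn g : measurable_fun setT g -> intg Pn g by exact: intg_empirical.
have mzX : measurable_fun setT (fun w => X' w * zeta w) by exact: measurable_funM.
have pln : play phi L Pn zeta psi by split => //; exact: iPn.
have fn : \int[Pn]_w f (X' w) < \int[P]_w f (X' w) + eps / 8.
  move: k1; rewrite smE; last exact: measurable_funB.
  rewrite (meanB (iPn _ mf) (intg_cst Pn1 _)) (mean_cst Pn1).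
  rewrite (meanB iif (intg_cst P1 _)) (mean_cst P1).
  by rewrite addrAC ltrD2r.
have up : (divergence_risk phi tau Pn X <=
    (D + eps / 8 + eps / 2 - B)%:E)%E.
  apply: le_trans (risk_le (M := D + eps / 8) dphi sphi Pn1 tau0 y0 B0 mX XB _) _; last first.
    by rewrite yE.
  move=> z p plz z1 pt.
  apply: (le_trans (mean_play_le_tconj dphi L1 (ltW lam0) Pn1 mX' Xb nu0 plz z1 pt)).
  rewrite -/f; move: fn Ef; move: (\int[Pn]_w _) (\int[P]_w _) => u1 u2; clear; lra.
(* Under [P] the divergence leaves room [eps / 6 - eta] after multiplication by [lam]. The sample
   uses [eps / 8] of it for [U] and [c] for the gap. *)
have psin : \int[Pn]_w psi w <= tau.
  rewrite -(ler_pM2l lam0) mean_empirical// mulrCA mulr_sumr.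
  apply: (@le_trans _ _ (n%:R^-1 * \sum_(i < n) (U (x i) + c))).
    apply: ler_wpM2l; first by rewrite invr_ge0 ltW.
    apply: ler_sum => i _; have /andP[_ h] := Ub (x i).
    by apply: (le_trans h); rewrite lerD2l; apply: ltW; exact: k5.
  rewrite big_split/= mulrDr big_const_ord iter_addr_0 -(mulr_natl c) mulKf ?gt_eqF//.
  have EU : \int[P]_w U w <= lam * \int[P]_w psi w.
    rewrite -meanZ//; apply: le_mean => //; first exact: intgZ.
    by move=> w; case/andP: (Ub w).
  move: k4 pa etac EU; rewrite /sample_mean -/x -/U /c.
  move: (_ * \sum_(i < n) _) (\int[P]_w psi w) (\int[P]_w _) => u1 u2 u3.
  by clear - h0; lra.
have low := risk_ge dphi sphi Pn1 mX XB pln psin.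
have massE (mu : {measure set T -> \bar R}) : intg mu zeta -> intg mu (fun w => X' w * zeta w) ->
    \int[mu]_w ((2 * B - X' w) * zeta w) = 2 * B * \int[mu]_w zeta w - \int[mu]_w (X' w * zeta w).
  move=> i1 i2; rewrite -meanZ// -meanB//; last exact: intgZ.
  by congr (Rintegral _ _ _); apply/funext => w; ring.
have iz := play_intg dphi P1 pl; have izX := play_intgX dphi P1 mX' Xb pl.
have k2' : \int[P]_w (X' w * zeta w) - eps / 8 <= \int[Pn]_w (X' w * zeta w).
  move: k2; rewrite smE; last exact: measurable_funM.
  rewrite (meanZ _ (iPn _ mzX)) (meanZ _ izX).
  by move: (\int[Pn]_w _) (\int[P]_w _) => u1 u2; clear; lra.
have k3' : \int[P]_w (X' w * zeta w) - eps / 8 <=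
    \int[Pn]_w (X' w * zeta w) - 2 * B * (\int[Pn]_w zeta w - 1).
  move: k3; rewrite smE; last by apply: measurable_funM => //; exact: measurable_funB.
  rewrite (massE _ iz izX) (massE _ (iPn _ mz) (iPn _ mzX)) m1.
  move: (\int[Pn]_w (X' w * _)) (\int[Pn]_w zeta w) (\int[P]_w _) => u1 u2 u3.
  by clear; lra.
have low' : ((\int[P]_w (X' w * zeta w) - eps / 8 - B)%:E <= divergence_risk phi tau Pn X)%E.
  apply: le_trans low; rewrite lee_fin lerD2r.
  (* Without excess mass [k2'] applies, otherwise [k3']. *)
  by case: (leP (\int[Pn]_w zeta w - 1) 0) => _; rewrite ?mulr0 ?subr0.
have lowP := play_value_le_risk y dphi sphi P1 tau0 mX XB.
have upP := risk_le_play_value dphi sphi P1 tau0 y0 B0 mX XB.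
rewrite yE in upP.
have finE (A : \bar R) l u : (l%:E <= A)%E -> (A <= u%:E)%E ->
    exists2 v, A = v%:E & l <= v <= u.
  by case: A => [v| |] //=; rewrite ?lee_fin => lv vu; exists v => //; rewrite lv.
have [v1 e1 /andP[v1a v1b]] := finE _ _ _ lowP upP.
have [v2 e2 /andP[v2a v2b]] := finE _ _ _ low' up.
rewrite -/Pn e1 e2 -EFinB /= lee_fin ler_norml.
move: Dr zr v1a v1b v2a v2b etac.
rewrite -[L]/(growth_inv phi y).
move: (play_value _ _ _ _ _) (\int[P]_w _) => u1 u2; rewrite /c.
by clear - h0 => *; apply/andP; split; lra.
Qed.

(** The empirical risk is a Lipschitz function [F] of the values [X (Y i s)]. Both sides of the
    absolute value are handled by applying [lipschitz_measurable_gt] to [F] and to [- F]; for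
    infinite [r] the set is empty. *)
Lemma measurable_risk_deviation (R : realType) (phi : R -> \bar R) (tau eps : R)
    (d dS : measure_display) (T : measurableType d) (S : measurableType dS)
    (X : T -> R) (n : nat) (Y : 'I_n -> S -> T) (r : \bar R) :
  divergence_function phi -> 0 < tau -> measurable_fun setT X -> (0 < n)%N ->
  (forall i, measurable_fun setT (Y i)) ->
  measurable [set s | `| r - divergence_risk phi tau (empirical (fun i => Y i s)) X |
                      <= eps%:E]%E.
Proof.
move=> dphi tau0 mX n0 mY.
pose F := weighted_risk phi tau (n := n).
pose U i s := X (Y i s).
have mU i : measurable_fun setT (U i) by exact: measurableT_comp mX (mY i).
have FE s : divergence_risk phi tau (empirical (fun i => Y i s)) X = (F (fun i => U i s))%:E.
  exact: divergence_risk_empirical.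
have FL (u v : 'I_n -> R) (e : R) : (forall i, `|u i - v i| <= e) -> F u <= F v + e.
  exact: weighted_risk_lipschitz.
have FLn (u v : 'I_n -> R) (e : R) : (forall i, `|u i - v i| <= e) -> - F u <= - F v + e.
  move=> h; rewrite lerNl opprD opprK lerBlDr; apply: FL => i.
  by rewrite distrC.
have m1 c := lipschitz_measurable_gt n0 FL mU c.
have m2 c := lipschitz_measurable_gt n0 FLn mU c.
case: r => [v| |].
- rewrite (_ : [set s | _] = ~` [set s | v + eps < F (fun i => U i s)] `&`
      ~` [set s | eps - v < - F (fun i => U i s)]).
    by apply: measurableI; apply: measurableC.
  apply/seteqP; split => s /=; rewrite FE -EFinB /= lee_fin ler_norml.
    by move=> /andP[h1 h2]; split; apply/negP; rewrite -leNgt; lra.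
  by move=> [/negP h1 /negP h2]; rewrite -!leNgt in h1 h2; apply/andP; split; lra.
- rewrite (_ : [set s | _] = set0)//.
  by apply/seteqP; split => s //=; rewrite FE.
- rewrite (_ : [set s | _] = set0)//.
  by apply/seteqP; split => s //=; rewrite FE.
Qed.

Theorem corollary3p1 (R : realType) (phi : R -> \bar R) (tau : R)
    (d : measure_display) (T : measurableType d) (P : probability T R)
    (B : R) (X : T -> R) (eps delta : R) (n : nat)
    (dS : measure_display) (S : measurableType dS) (Q : probability S R)
    (Y : 'I_n -> S -> T) :
  divergence_function phi ->
  superlinear phi ->
  0 < tau ->
  measurable_fun setT X ->
  (forall w, - B <= X w <= B) ->
  0 < eps <= B ->
  0 < delta < 1 ->
  iid_samples P Q Y ->
  (* 2 ^+ 15 = 32768, too large for a literal in unary representation *)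
  2 ^+ 15 * sup [set Mval phi B tau eps' * eps' | eps' in `[eps, B]]
        * log_term phi B tau eps delta / eps ^+ 2
    + 64 * Mval phi B tau eps * log_term phi B tau eps delta / eps <= n%:R ->
  ((1 - delta)%:E <=
    Q [set s | `| divergence_risk phi tau P X
                  - divergence_risk phi tau (empirical (fun i => Y i s)) X |
               <= eps%:E])%E.
Proof.
move=> dphi sphi tau0 mX XB /andP[eps0 epsB] d01 iidY hn.
have /andP[d0 d1] := d01.
have [lt0 elt] := log_term_bound sphi tau0 eps0 epsB d01.
have B0 : 0 < B by exact: lt_le_trans epsB.
have S5 := sup_ge_sqr sphi tau0 eps0 epsB.
set SM := sup _ in hn S5; set lt := log_term _ _ _ _ _ in hn lt0 elt.
have S0 : 0 < SM by apply: lt_le_trans S5; rewrite mulr_gt0// exprn_gt0.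
have e2 : 0 < eps ^+ 2 by rewrite exprn_gt0.
have M0 : 0 <= Mval phi B tau eps.
  have := Lval_ge1 tau B sphi eps; rewrite /Mval => L1.
  by rewrite mulr_ge0 ?(ltW B0)//; lra.
have hn1 : 2 ^+ 15 * SM * lt / eps ^+ 2 <= n%:R.
  apply: le_trans hn; rewrite lerDl.
  by apply: divr_ge0; [apply: mulr_ge0; [exact: mulr_ge0|exact: ltW]|exact: ltW].
(* The product of the denominators in the Bernstein exponent, compared with [2 ^+ 15] through powers
   of 2. *)
have [K [K0 K15 KE]] : exists K : R, [/\ 0 < K, K <= 2 ^+ 15 & K = 64 * 8 * 4].
  exists (2 ^+ 6 * 2 ^+ 3 * 2 ^+ 2); split; first by rewrite !mulr_gt0// exprn_gt0.
    by rewrite -!exprD ler_weXn2l// ler1n.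
  by rewrite -!natrX.
have hn2 : K * SM * lt <= n%:R * eps ^+ 2.
  rewrite -ler_pdivrMr//; apply: le_trans hn1.
  by rewrite ler_pM2r ?invr_gt0// ler_pM2r// ler_pM2r.
(* The bound on [n] has a positive left-hand side, so the empirical measure is a probability. *)
have n0 : (0 < n)%N.
  rewrite -(ltr0n R) -(pmulr_lgt0 _ e2); apply: lt_le_trans hn2.
  exact: (mulr_gt0 (mulr_gt0 K0 S0) lt0).
have n_large : expR (- (n%:R * (eps / (64 * SM) * (eps / 8)) / 4)) <= delta / 5.
  apply: le_trans elt; rewrite ler_expR lerN2.
  rewrite (_ : _ / 4 = n%:R * eps ^+ 2 / (K * SM)); last by rewrite KE; field; rewrite gt_eqF.
  rewrite ler_pdivlMr; last exact: mulr_gt0.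
  by rewrite mulrC.
have [E [mE QE EP]] := risk_deviation_event dphi sphi tau0 mX XB eps0 epsB d0 iidY n0 n_large.
have [mY _ _] := iidY.
set G := [set s | _].
have mG : measurable G by exact: measurable_risk_deviation.
have sub : ~` G `<=` E.
  by move=> s nG; apply: contrapT => nE; apply: nG; exact: EP.
have mGC := measurableC mG.
have -> : Q G = (1 - Q (~` G))%E by rewrite -[in LHS](setCK G) probability_setC.
rewrite EFinB leeB//; apply: le_trans QE.
by apply: le_measure => //; rewrite inE.
Qed.
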